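(* Let $\nu>0$ be a real number and let $K_\nu(t;z,z_0)$ denote the heat kernel of the magnetic Laplacian $\Delta_\nu = -\dfrac{\partial^2}{\partial z\,\partial\overline{z}} + \nu z\,\dfrac{\partial}{\partial z}$ on $L^2(\mathbb{C}; e^{-\nu|z|^2}d\lambda)$. Then for every $t>0$ and all $z,z_0\in\mathbb{C}$, $$K_\nu(t;z,z_0) = \frac{\nu}{\pi}\; \frac{e^{\nu(t+\langle z_0,z\rangle)}}{e^{\nu t}-1}\; \exp\left(\frac{-\nu|z-z_0|^2}{e^{\nu t}-1}\right).$$
   Context: Here $\lambda$ is Lebesgue measure on $\mathbb{C}$, $\langle z_0,z\rangle = z_0\overline{z}$, and $\partial/\partial z=\frac12(\partial_x-i\partial_y)$, $\partial/\partial\overline{z}=\frac12(\partial_x+i\partial_y)$ for $z=x+iy$. The operator $\Delta_\nu$ is considered as a self-adjoint operator on the Hilbert space $L^2(\mathbb{C}; e^{-\nu|z|^2}d\lambda)$. For nonnegative integers $m,n$, the complex Hermite polynomials $$H_{m,n}^{\nu}(z,\overline{z}) = (-1)^{m+n} e^{\nu z\overline{z}}\, \frac{\partial^{m+n}}{\partial \overline{z}^{m}\,\partial z^{n}}\left(e^{-\nu z\overline{z}}\right)$$ form an orthogonal basis of this Hilbert space, with $\|H_{m,n}^\nu\|^2 = \frac{\pi}{\nu}\,\nu^{m+n}\,m!\,n!$, and they are eigenfunctions: $\Delta_\nu H_{m,n}^{\nu} = \nu m\, H_{m,n}^{\nu}$; the self-adjoint realization meant is the one diagonalized by this basis. For a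 self-adjoint operator $L$ with a complete orthonormal system of eigenfunctions $\{e_j\}$ and corresponding eigenvalues $\lambda_j$, the heat kernel is $$K(t;z,z_0)=\sum_{j} e^{-\lambda_j t}\, e_j(z)\,\overline{e_j(z_0)}.$$ Thus $K_\nu$ is the kernel, with respect to the measure $e^{-\nu|z_0|^2}d\lambda(z_0)$, of the solution operator $e^{-t\Delta_\nu}$ of the Cauchy problem $\partial_t u(t;z) = -\Delta_\nu u(t;z)$, $t>0$, $u(0;z)=f(z)\in \mathcal{C}_0^\infty(\mathbb{C})$. *)

(* Defs.v *)
From HB Require Import structures.
From mathcomp Require Import all_boot all_order all_algebra finmap complex.
From mathcomp Require Import all_classical all_reals all_analysis.
From mathcomp.analysis.showcase Require Import summability.

Set Implicit Arguments.
Unset Strict Implicit.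
Unset Printing Implicit Defensive.
Import Order.TTheory GRing.Theory Num.Theory.
Import numFieldNormedType.Exports.

Local Open Scope classical_set_scope.
Local Open Scope ring_scope.

Notation "x %:C" := (real_complex _ x) (format "x %:C") : ring_scope.
Notation "x +i* y" := (Complex x y) : ring_scope.

Section Defs.
Context {R : realType}.
Local Notation C := R[i].
Implicit Types (nu t : R) (z w : C) (f : C -> C).

Definition cexp z : C :=
  (expR (complex.Re z))%:C * (cos (complex.Im z) +i* sin (complex.Im z)).

(* Real partial derivatives of f, viewed as a function of (x, y) with
   z = x + i y; derivatives in the library's sense on C itself would be
   complex derivatives. *)
Definition partial_x f z : C :=
  derive1 (fun s : R => complex.Re (f (s +i* complex.Im z))) (complex.Re z) +i*
  derive1 (fun s : R => complex.Im (f (s +i* complex.Im z))) (complex.Re z).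

Definition partial_y f z : C :=
  derive1 (fun s : R => complex.Re (f (complex.Re z +i* s))) (complex.Im z) +i*
  derive1 (fun s : R => complex.Im (f (complex.Re z +i* s))) (complex.Im z).

Definition dz f z : C := (partial_x f z - 'i * partial_y f z) / 2.
Definition dzbar f z : C := (partial_x f z + 'i * partial_y f z) / 2.

Definition magnetic_laplacian nu f z : C :=
  - dz (dzbar f) z + nu%:C * z * dz f z.

(* The norm of L^2(C; e^{-nu |z|^2} dlambda). *)
Definition L2norm nu f : R :=
  Num.sqrt (\int[(lebesgue_measure \x lebesgue_measure)%E]_p
    (Normc.normc (f (p.1 +i* p.2)) ^+ 2 *
     expR (- nu * Normc.normc (p.1 +i* p.2) ^+ 2))).

Definition hermite nu (m n : nat) z : C :=
  (-1) ^+ (m + n) * cexp (nu%:C * (z * z^*)) *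
  iter m dzbar (iter n dz (fun w => cexp (- (nu%:C * (w * w^*))))) z.

Definition hermite_onb nu (j : nat * nat) z : C :=
  hermite nu j.1 j.2 z / (L2norm nu (hermite nu j.1 j.2))%:C.

Definition eigenfunction (L : (C -> C) -> C -> C) (a : R) f : Prop :=
  (exists z, f z != 0) /\ forall z, L f z = a%:C * f z.

(* [e] is meant to be the complete orthonormal system that diagonalizes the
   self-adjoint realization of [L].  The index set carries no preferred order:
   the series converges along the net of finite subsets of [I]. *)
Definition is_heat_kernel (I : choiceType) (L : (C -> C) -> C -> C)
    (e : I -> C -> C) (K : R -> C -> C -> C) : Prop :=
  exists lam : I -> R,
    (forall j, eigenfunction L (lam j) (e j)) /\
    forall t z z0, 0 < t ->
      partial_sum (fun j => (expR (- lam j * t))%:C * e j z * (e j z0)^*)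
        @ totally --> (K t z z0 : C^o).

End Defs.

(* Main.v *)
(** [H_{m,n}] is a polynomial in [z] and [z^*] given by the three-term recursion
    [H_{m+1,n} = nu z H_{m,n} - nu n H_{m,n-1}]; it satisfies
    [dz H_{m,n} = nu m H_{m-1,n}] and [dzbar H_{m,n} = nu n H_{m,n-1}], so it is
    an eigenfunction with eigenvalue [nu m].  Integration by parts against the
    Gaussian turns the recursion into
    [||H_{m+1,n}||^2 = nu (m + 1) ||H_{m,n}||^2].

    For fixed [m] and [k], the sums
    [F_{m,k} = \sum_n H_{m,n}(z) (H_{k,n}(w))^* / (nu^n n!)] inherit from it the
    recursion [F_{m+1,k} = nu (z - w) F_{m,k} + nu k F_{m,k-1}], whence
    [F_{m,k} = exp(nu z^* w) (-1)^k H_{m,k}(z - w)].  The diagonal values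
    [H_{m,m}(z)] are Laguerre polynomials in [nu |z|^2], and their generating
    function sums the remaining series in [m].  At [z = w] all terms are
    nonnegative, so the double series converges there; the arithmetic-geometric
    inequality then gives unconditional convergence everywhere. *)
Require Import Defs.
From mathcomp Require Import all_boot all_order all_algebra complex.
From mathcomp Require Import all_classical all_reals all_analysis.
From mathcomp Require Import finmap ring measurable_realfun.
From mathcomp.analysis.showcase Require Import summability.
Import Order.TTheory GRing.Theory Num.Theory.
Import numFieldNormedType.Exports.
Local Open Scope ring_scope.

Set Implicit Arguments.
Unset Strict Implicit.
Unset Printing Implicit Defensive.

(** * Wirtinger calculus *)

(** Existence and value of a sum are kept apart. The kernel series runs over unordered finite sets
    of pairs, so its iterated sums alone do not determine it: [summable_kernel_term] first produces
    some sum by domination, and only then does [has_sum_rows] allow an evaluation row by row. The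
    exponential, binomial and Laguerre series are treated in the same order. Only the level sums
    with [k = m] enter the kernel, but the recursion in [m] also brings in [k - 1], so the induction
    has to carry both indices. In [is_heat_kernel] the eigenvalues are existentially quantified.
    Each basis function is nonzero, which determines its eigenvalue, and uniqueness of limits then
    gives the implication from left to right. *)

Section ComplexDerivative.
Context {R : realType}.
Local Notation C := R[i].
Local Notation Re := (@complex.Re R).
Local Notation Im := (@complex.Im R).
Implicit Types (g h : R -> C) (s : R) (d e z a b : C) (f : C -> C).

Lemma Re_mulc z e : Re (z * e) = Re z * Re e - Im z * Im e.
Proof. by case: z e => ? ? []. Qed.

Lemma Im_mulc z e : Im (z * e) = Re z * Im e + Im z * Re e.
Proof. by case: z e => ? ? []. Qed.

Lemma Re_addc z e : Re (z + e) = Re z + Re e.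
Proof. by case: z e => ? ? []. Qed.

Lemma Im_addc z e : Im (z + e) = Im z + Im e.
Proof. by case: z e => ? ? []. Qed.

Lemma complex_eq z e : Re z = Re e -> Im z = Im e -> z = e.
Proof. by case: z e => ? ? [? ?] /= -> ->. Qed.

(** Stated as a relation so that differentiability travels with the value: [derive1] is total, and
    an equation about it would not feed the product and chain rules. *)
Definition cderiv g s d : Prop :=
  is_derive s 1 (fun u => Re (g u)) (Re d) /\
  is_derive s 1 (fun u => Im (g u)) (Im d).

Lemma cderiv_eq g s d e : cderiv g s d -> d = e -> cderiv g s e.
Proof. by move=> ? <-. Qed.

Lemma cderiv_cst d s : cderiv (fun=> d) s 0.
Proof. by split; exact: is_derive_cst. Qed.

Lemma cderivD g h s d e :
  cderiv g s d -> cderiv h s e -> cderiv (fun u => g u + h u) s (d + e).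
Proof.
move=> [gr gi] [hr hi]; split; rewrite ?Re_addc ?Im_addc.
  rewrite (_ : (fun u => _) = (fun u => Re (g u)) + (fun u => Re (h u))).
    exact: is_deriveD.
  by apply/funext => u; rewrite Re_addc.
rewrite (_ : (fun u => _) = (fun u => Im (g u)) + (fun u => Im (h u))).
  exact: is_deriveD.
by apply/funext => u; rewrite Im_addc.
Qed.

Lemma cderivM g h s d e : cderiv g s d -> cderiv h s e ->
  cderiv (fun u => g u * h u) s (d * h s + g s * e).
Proof.
move=> [gr gi] [hr hi].
pose gR u := Re (g u); pose gI u := Im (g u).
pose hR u := Re (h u); pose hI u := Im (h u).
split.
  rewrite (_ : (fun u => _) = gR * hR - gI * hI); last first.
    by apply/funext => u; rewrite Re_mulc.
  apply: is_derive_eq (is_deriveB (is_deriveM gr hr) (is_deriveM gi hi)) _.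
  by rewrite Re_addc !Re_mulc /GRing.scale /= /gR /gI /hR /hI; ring.
rewrite (_ : (fun u => _) = gR * hI + gI * hR); last first.
  by apply/funext => u; rewrite Im_mulc.
apply: is_derive_eq (is_deriveD (is_deriveM gr hi) (is_deriveM gi hr)) _.
by rewrite Im_addc !Im_mulc /GRing.scale /= /gR /gI /hR /hI; ring.
Qed.

Lemma cderiv_comp_cexp g s d :
  cderiv g s d -> cderiv (fun u => cexp (g u)) s (d * cexp (g s)).
Proof.
move=> [gr gi].
have de : is_derive s 1 (fun u => expR (Re (g u))) (expR (Re (g s)) * Re d).
  exact: (is_derive1_comp (f := expR)).
have dc : is_derive s 1 (fun u => cos (Im (g u))) (- sin (Im (g s)) * Im d).
  exact: (is_derive1_comp (f := cos)).
have ds : is_derive s 1 (fun u => sin (Im (g u))) (cos (Im (g s)) * Im d).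
  exact: (is_derive1_comp (f := sin)).
pose e u := expR (Re (g u)); pose c u := cos (Im (g u)).
pose si u := sin (Im (g u)).
split.
  rewrite (_ : (fun u => _) = e * c); last first.
    by apply/funext => u; rewrite Re_mulc /= mul0r subr0.
  apply: is_derive_eq (is_deriveM de dc) _.
  by rewrite Re_mulc /cexp Re_mulc Im_mulc /= /GRing.scale /= /e /c; ring.
rewrite (_ : (fun u => _) = e * si); last first.
  by apply/funext => u; rewrite Im_mulc /= mul0r addr0.
apply: is_derive_eq (is_deriveM de ds) _.
by rewrite Im_mulc /cexp Re_mulc Im_mulc /= /GRing.scale /= /e /si; ring.
Qed.

(* [a] and [b] are the values of [dz f] and [dzbar f] at [z]:
   [d/dx = dz + dzbar] and [d/dy = i (dz - dzbar)]. *)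
Definition wirtinger f z a b : Prop :=
  cderiv (fun s => f (s +i* Im z)) (Re z) (a + b) /\
  cderiv (fun s => f (Re z +i* s)) (Im z) ('i * (a - b)).

Lemma complex_etaE z : Re z +i* Im z = z.
Proof. by case: z. Qed.

Lemma wirtinger_eq f z a b a' b' :
  wirtinger f z a b -> a = a' -> b = b' -> wirtinger f z a' b'.
Proof. by move=> ? <- <-. Qed.

Lemma cderiv_derive1 g s d : cderiv g s d ->
  derive1 (fun u => Re (g u)) s +i* derive1 (fun u => Im (g u)) s = d.
Proof. by move=> [? ?]; rewrite !derive1E !derive_val complex_etaE. Qed.

Lemma mul_i_i a : 'i * ('i * a) = - a.
Proof. by rewrite mulrA -expr2 sqrCi mulN1r. Qed.

Lemma wirtinger_dz f z a b : wirtinger f z a b -> dz f z = a.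
Proof.
move=> [dx dy].
rewrite /dz /partial_x /partial_y (cderiv_derive1 dx) (cderiv_derive1 dy).
by rewrite mul_i_i; field.
Qed.

Lemma wirtinger_dzbar f z a b : wirtinger f z a b -> dzbar f z = b.
Proof.
move=> [dx dy].
rewrite /dzbar /partial_x /partial_y (cderiv_derive1 dx) (cderiv_derive1 dy).
by rewrite mul_i_i; field.
Qed.

Lemma wirtinger_cst a z : wirtinger (fun=> a) z 0 0.
Proof.
by split; apply: cderiv_eq (cderiv_cst _ _) _; rewrite ?subrr ?addr0 ?mulr0.
Qed.

Lemma wirtinger_id z : wirtinger id z 1 0.
Proof.
split; split=> /=.
- by apply: (is_derive_eq (is_derive_id _ _)); ring.
- by apply: (is_derive_eq (is_derive_cst _ _ _)); ring.
- by apply: (is_derive_eq (is_derive_cst _ _ _)); ring.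
- by apply: (is_derive_eq (is_derive_id _ _)); ring.
Qed.

Lemma wirtinger_conj z : wirtinger (fun w => w^*) z 0 1.
Proof.
split; split=> /=.
- by apply: (is_derive_eq (is_derive_id _ _)); ring.
- by apply: (is_derive_eq (is_derive_cst _ _ _)); ring.
- by apply: (is_derive_eq (is_derive_cst _ _ _)); ring.
- by apply: (is_derive_eq (is_deriveN (is_derive_id _ _))); ring.
Qed.

Lemma wirtingerD f1 f2 z a1 b1 a2 b2 :
  wirtinger f1 z a1 b1 -> wirtinger f2 z a2 b2 ->
  wirtinger (fun w => f1 w + f2 w) z (a1 + a2) (b1 + b2).
Proof.
move=> [dx1 dy1] [dx2 dy2]; split.
  by apply: cderiv_eq (cderivD dx1 dx2) _; ring.
by apply: cderiv_eq (cderivD dy1 dy2) _; ring.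
Qed.

Lemma wirtingerM f1 f2 z a1 b1 a2 b2 :
  wirtinger f1 z a1 b1 -> wirtinger f2 z a2 b2 ->
  wirtinger (fun w => f1 w * f2 w) z
    (a1 * f2 z + f1 z * a2) (b1 * f2 z + f1 z * b2).
Proof.
move=> [dx1 dy1] [dx2 dy2]; split.
  by apply: cderiv_eq (cderivM dx1 dx2) _; rewrite complex_etaE; ring.
by apply: cderiv_eq (cderivM dy1 dy2) _; rewrite complex_etaE; ring.
Qed.

Lemma wirtingerZ f z c a b :
  wirtinger f z a b -> wirtinger (fun w => c * f w) z (c * a) (c * b).
Proof.
by move=> /(wirtingerM (wirtinger_cst c z)); rewrite !mul0r !add0r.
Qed.

Lemma wirtinger_cexp f z a b : wirtinger f z a b ->
  wirtinger (fun w => cexp (f w)) z (a * cexp (f z)) (b * cexp (f z)).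
Proof.
move=> [dx dy]; split.
  by apply: cderiv_eq (cderiv_comp_cexp dx) _; rewrite complex_etaE; ring.
by apply: cderiv_eq (cderiv_comp_cexp dy) _; rewrite complex_etaE; ring.
Qed.

Lemma wirtingerX f z a b n : wirtinger f z a b ->
  wirtinger (fun w => f w ^+ n) z (n%:R * f z ^+ n.-1 * a)
    (n%:R * f z ^+ n.-1 * b).
Proof.
move=> df; elim: n => [|n IHn].
  by apply: wirtinger_eq (wirtinger_cst 1 z) _ _; rewrite !mul0r.
rewrite (_ : (fun w => _) = (fun w => f w * f w ^+ n)); last first.
  by apply/funext => w; rewrite exprS.
have e c : c * f z ^+ n + f z * (n%:R * f z ^+ n.-1 * c) =
    n.+1%:R * f z ^+ n.+1.-1 * c.
  case: n {IHn} => [|n]; first by rewrite expr0; ring.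
  by rewrite /= exprS -[n.+2%:R]natr1 -[n.+1%:R]natr1; ring.
by apply: wirtinger_eq (wirtingerM df IHn) _ _; exact: e.
Qed.

End ComplexDerivative.

(** * The complex exponential *)

Section ComplexExponential.
Context {R : realType}.
Local Notation C := R[i].
Implicit Types (z w : C) (x : R).

Lemma cexpD z w : cexp (z + w) = cexp z * cexp w.
Proof.
apply: complex_eq; rewrite /cexp !(Re_mulc, Im_mulc, Re_addc, Im_addc) /=.
  by rewrite expRD cosD; ring.
by rewrite expRD sinD; ring.
Qed.

Lemma cexp_real x : cexp x%:C = (expR x)%:C.
Proof. by rewrite /cexp /= cos0 sin0; exact: mulr1. Qed.

Lemma cexp0 : cexp 0 = 1 :> C.
Proof. by rewrite (cexp_real 0) expR0. Qed.

Lemma cexpNl z : cexp (- z) * cexp z = 1.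
Proof. by rewrite -cexpD addNr cexp0. Qed.

End ComplexExponential.

(** * Complex Hermite polynomials *)

Section HermitePolynomials.
Context {R : realType}.
Local Notation C := R[i].
Variable nu : R.
Implicit Types (z w : C) (m n : nat).

(** At [n = 0] the truncated [n.-1] is harmless, because the factor [n%:R] vanishes; the later
    formulas with predecessors rely on the same convention. *)
Fixpoint hermite_poly m n z : C :=
  if m is k.+1 then
    nu%:C * z * hermite_poly k n z - nu%:C * n%:R * hermite_poly k n.-1 z
  else (nu%:C * z^*) ^+ n.

Arguments hermite_poly : simpl never.

Lemma hermite_poly0 n z : hermite_poly 0 n z = (nu%:C * z^*) ^+ n.
Proof. by []. Qed.

Lemma hermite_polySl m n z : hermite_poly m.+1 n z =
  nu%:C * z * hermite_poly m n z - nu%:C * n%:R * hermite_poly m n.-1 z.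
Proof. by []. Qed.

(** The recursion one index down; the factor [m] makes it valid at [m = 0] too. *)
Lemma natmul_hermite_polyl m n z : m%:R * hermite_poly m n z =
  m%:R * (nu%:C * z * hermite_poly m.-1 n z -
          nu%:C * n%:R * hermite_poly m.-1 n.-1 z).
Proof. by case: m => [|m] //; rewrite !mul0r. Qed.

(** This is the conjugate of the defining recursion, but the symmetry under conjugation is itself
    deduced from it, so it needs its own induction. *)
Lemma hermite_polySr m n z : hermite_poly m n.+1 z =
  nu%:C * z^* * hermite_poly m n z - nu%:C * m%:R * hermite_poly m.-1 n z.
Proof.
elim: m n => [|m IHm] n; first by rewrite !hermite_poly0 exprS; ring.
rewrite !hermite_polySl !succnK IHm.
have := natmul_hermite_polyl m n z.
have : n%:R * hermite_poly m n z = n%:R *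
    (nu%:C * z^* * hermite_poly m n.-1 z -
     nu%:C * m%:R * hermite_poly m.-1 n.-1 z).
  by case: n => [|n]; rewrite ?mul0r ?IHm.
rewrite -[n.+1%:R]natr1 -[m.+1%:R]natr1.
move: (hermite_poly m n z) (hermite_poly m.-1 n z) (hermite_poly m n.-1 z)
  (hermite_poly m.-1 n.-1 z) => h h1 h2 h3 en em.
apply/eqP; rewrite -subr_eq0; apply/eqP.
(* The difference of the two sides is arranged so that [m%:R * h] and [n%:R * h] occur as such;
   replacing them by their lowered recursions makes everything cancel. *)
transitivity (nu%:C * (m%:R * h) - nu%:C * (n%:R * h) -
   nu%:C * z * nu%:C * m%:R * h1 + nu%:C * n%:R * nu%:C * z^* * h2).
  by ring.
by rewrite en em; ring.
Qed.

Lemma wirtinger_hermite_poly m n z :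
  wirtinger (hermite_poly m n) z (nu%:C * m%:R * hermite_poly m.-1 n z)
    (nu%:C * n%:R * hermite_poly m n.-1 z).
Proof.
elim: m n => [|m IHm] n.
  apply: wirtinger_eq (wirtingerX n (wirtingerZ nu%:C (wirtinger_conj z))) _ _.
    by rewrite mulr0n; ring.
  by rewrite hermite_poly0; ring.
rewrite (_ : hermite_poly m.+1 n = fun w => nu%:C * w * hermite_poly m n w +
    - (nu%:C * n%:R) * hermite_poly m n.-1 w); last first.
  by apply/funext => w; rewrite hermite_polySl mulNr.
have dzw := wirtingerM (wirtingerZ nu%:C (wirtinger_id z)) (IHm n).
have dw := wirtingerZ (- (nu%:C * n%:R)) (IHm n.-1).
apply: wirtinger_eq (wirtingerD dzw dw) _ _ => /=.
  have := natmul_hermite_polyl m n z.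
  move: (hermite_poly m n z) (hermite_poly m.-1 n z)
    (hermite_poly m.-1 n.-1 z) => h h1 h2 em.
  (* The product rule leaves [h] plus [m] times the lowered recursion, that is [(m + 1) h]. *)
  transitivity (nu%:C * (h + m%:R * (nu%:C * z * h1 - nu%:C * n%:R * h2))).
    by ring.
  by rewrite -em -[m.+1%:R]natr1; ring.
case: n {dzw dw} => [|n]; first by rewrite mulr0n; ring.
by rewrite hermite_polySl /=; ring.
Qed.

(** The two terms of the operator give [nu m] times [nu z H_{m-1,n} - nu n H_{m-1,n-1}], which is
    the recursion for [H_{m,n}]. The constant [c] makes room for the normalisation. *)
Lemma eigen_hermite_poly c m n z :
  magnetic_laplacian nu (fun w => c * hermite_poly m n w) z =
  (nu * m%:R)%:C * (c * hermite_poly m n z).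
Proof.
rewrite /magnetic_laplacian.
have -> : dzbar (fun w => c * hermite_poly m n w) =
    (fun w => c * (nu%:C * n%:R) * hermite_poly m n.-1 w).
  apply/funext => w.
  rewrite (wirtinger_dzbar (wirtingerZ c (wirtinger_hermite_poly m n w))).
  by rewrite mulrA.
rewrite (wirtinger_dz (wirtingerZ _ (wirtinger_hermite_poly m n.-1 z))).
rewrite (wirtinger_dz (wirtingerZ c (wirtinger_hermite_poly m n z))).
rewrite rmorphM rmorph_nat -[RHS]mulrA [m%:R * _]mulrCA.
rewrite natmul_hermite_polyl.
by ring.
Qed.

Local Notation gaussian := (fun w : C => cexp (- (nu%:C * (w * w^*)))).

Lemma wirtinger_gaussian z : wirtinger gaussian z
  (- nu%:C * z^* * gaussian z) (- nu%:C * z * gaussian z).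
Proof.
rewrite (_ : gaussian = fun w => cexp (- nu%:C * (w * w^*))); last first.
  by apply/funext => w; rewrite mulNr.
have dww := wirtingerM (wirtinger_id z) (wirtinger_conj z).
by apply: wirtinger_eq (wirtinger_cexp (wirtingerZ (- nu%:C) dww)) _ _; ring.
Qed.

Lemma iter_dz_gaussian n :
  iter n dz gaussian = fun z => (- nu%:C * z^*) ^+ n * gaussian z.
Proof.
elim: n => [|n IHn] /=; first by apply/funext => z; rewrite mul1r.
apply/funext => z; rewrite IHn.
have dp := wirtingerX n (wirtingerZ (- nu%:C) (wirtinger_conj z)).
rewrite (wirtinger_dz (wirtingerM dp (wirtinger_gaussian z))).
by rewrite exprS; ring.
Qed.

(** One more [dzbar] lowers [n] in the polynomial factor and brings down [- nu z] from the Gaussian: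
    together this is minus the recursion, and the sign goes into [(-1) ^+ (m + n)]. *)
Lemma hermiteE m n : hermite nu m n = hermite_poly m n.
Proof.
have rodrigues z : iter m dzbar (iter n dz gaussian) z =
    (-1) ^+ (m + n) * (hermite_poly m n z * gaussian z).
  rewrite iter_dz_gaussian.
  elim: m z => [|m IHm] z /=.
    by rewrite add0n hermite_poly0 [RHS]mulrA -exprMn mulN1r mulNr.
  rewrite (_ : iter m dzbar _ = fun z => (-1) ^+ (m + n) *
      (hermite_poly m n z * gaussian z)); last by apply/funext => w; exact: IHm.
  have dhg := wirtingerM (wirtinger_hermite_poly m n z) (wirtinger_gaussian z).
  rewrite (wirtinger_dzbar (wirtingerZ _ dhg)) addSn exprS hermite_polySl.
  by ring.
apply/funext => z; rewrite /hermite rodrigues.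
rewrite [X in X * _]mulrC -mulrA [X in _ * X]mulrA -exprMn mulrNN mulr1.
rewrite expr1n mul1r mulrCA [X in _ * X]mulrC cexpNl mulr1.
by [].
Qed.

End HermitePolynomials.

#[global] Arguments hermite_poly : simpl never.
(** * Gaussian integrals *)

Section GaussianMoments.
Context {R : realType}.
Local Open Scope classical_set_scope.
Local Notation mu := (@lebesgue_measure R).
Implicit Types (c x : R) (k : nat).

(** The fundamental theorem on [[-n, n]], followed by dominated convergence with [|f|] as majorant;
    hence decay of [F] along the integers suffices. *)
Lemma integral_derive_eq0 (F f : R -> R) :
  (forall x, is_derive x 1 F (f x)) -> continuous f ->
  mu.-integrable setT (EFin \o f) ->
  F n%:R @[n --> \oo] --> 0 -> F (- n%:R) @[n --> \oo] --> 0 ->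
  (\int[mu]_x (f x)%:E = 0)%E.
Proof.
move=> dF cf intf F0 F0'.
have cF : continuous F.
  by move=> x; apply/differentiable_continuous/derivable1_diffP; case: (dF x).
pose I n : set R := `[- n%:R, n%:R].
pose f_ n := (EFin \o f) \_ (I n).
have mf := measurable_int _ intf.
have ftc n : (\int[mu]_x f_ n x = (F n%:R - F (- n%:R))%:E)%E.
  rewrite /f_ -integral_mkcond /I.
  (* [continuous_FTC2] asks for a nondegenerate interval. *)
  have [->|n0] := eqVneq n 0%N.
    by rewrite oppr0 subrr set_itv1 integral_set1.
  rewrite EFinB; apply: continuous_FTC2.
  - by rewrite (@lt_trans _ _ 0) ?oppr_lt0 ?ltr0n ?lt0n.
  - exact: continuous_subspaceT.
  - split.
    + by move=> x _; case: (dF x).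
    + by apply: cvg_at_right_filter; exact: cF.
    + by apply: cvg_at_left_filter; exact: cF.
  - by move=> x _; rewrite derive1E derive_val.
have lim1 : (\int[mu]_x f_ n x)%E @[n --> \oo] --> (\int[mu]_x (f x)%:E)%E.
  have [] // := @dominated_convergence _ _ R mu setT measurableT f_
    (EFin \o f) (abse \o (EFin \o f)).
  - move=> n; rewrite /f_.
    have mI : measurable (I n : set (measurableTypeR R)).
      exact: measurable_itv.
    have i : mu.-integrable setT ((EFin \o f) \_ (I n)).
      by apply/(integrable_mkcond _ mI); exact: integrableS intf.
    exact: (measurable_int _ i).
  - apply: aeW => x _; apply: cvg_near_cst; near=> n.
    have xI : x \in I n.
      apply/mem_set; rewrite /I /= in_itv /= -ler_norml.
      by near: n; exact: nbhs_infty_ger.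
    by rewrite /f_ patchE xI.
  - exact: integrable_abse.
  - apply: aeW => x n _; rewrite /f_ patchE; case: ifP => //= _.
    by rewrite normr0 lee_fin.
apply: (cvg_unique _ lim1); first exact: ereal_hausdorff.
have -> : (fun n => \int[mu]_x f_ n x)%E = (fun n => (F n%:R - F (- n%:R))%:E).
  exact/funext/ftc.
by apply: cvg_EFin; [exact: nearW | rewrite -(subrr 0); exact: cvgB].
Unshelve. all: by end_near. Qed.

Definition gauss c x : R := expR (- (c * x ^+ 2)).

Lemma gauss_ge0 c x : 0 <= gauss c x.
Proof. exact: expR_ge0. Qed.

Lemma gauss_le1 c x : 0 <= c -> gauss c x <= 1.
Proof.
by move=> c0; rewrite -[leRHS]expR0 ler_expR oppr_le0 mulr_ge0 ?sqr_ge0.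
Qed.

Lemma is_derive_gauss c x :
  is_derive x 1 (gauss c) (- (2 * c * x) * gauss c x).
Proof.
have dq : is_derive x 1 (fun u => - (c * u ^+ 2)) (- (2 * c * x)).
  have := is_deriveN (is_deriveZ c (is_deriveX 2 (is_derive_id x (1 : R)))).
  by move=> d; apply: is_derive_eq d _; rewrite /GRing.scale /=; ring.
by rewrite mulrC; exact: (is_derive1_comp (f := expR)).
Qed.

Lemma continuous_gauss c : continuous (gauss c).
Proof.
move=> x; apply/differentiable_continuous/derivable1_diffP.
by case: (is_derive_gauss c x).
Qed.

(** A multiple of the centred normal density of variance [1 / (2 c)], whose integrability and total
    mass are known. *)
Lemma gauss_normal_pdf c x : 0 < c ->
  gauss c x = Num.sqrt (pi / c) * normal_pdf 0 (Num.sqrt (2 * c)^-1) x.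
Proof.
move=> c0; have c20 : 0 <= (2 * c)^-1 by rewrite invr_ge0 mulr_ge0 // ltW.
have e : (2 * c)^-1 *+ 2 = c^-1.
  by field; rewrite gt_eqF.
rewrite normal_pdfE; last by rewrite gt_eqF // sqrtr_gt0 invr_gt0 mulr_gt0.
rewrite /normal_peak /normal_fun sqr_sqrtr // -mulrnAl e.
rewrite [c^-1 * pi]mulrC mulrA divff ?mul1r; last first.
  by rewrite gt_eqF // sqrtr_gt0 divr_gt0 // pi_gt0.
by rewrite subr0 invrK mulNr mulrC.
Qed.

Lemma integrable_gauss c : 0 < c -> mu.-integrable setT (EFin \o gauss c).
Proof.
move=> c0; rewrite (_ : _ \o _ = fun x => (Num.sqrt (pi / c))%:E *
    (normal_pdf 0 (Num.sqrt (2 * c)^-1) x)%:E)%E; last first.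
  by apply/funext => x; rewrite /= gauss_normal_pdf.
by apply: integrableZl => //; exact: integrable_normal_pdf.
Qed.

Lemma Rintegral_gauss c : 0 < c ->
  \int[mu]_x gauss c x = Num.sqrt (pi / c).
Proof.
move=> c0.
transitivity (\int[mu]_x (Num.sqrt (pi / c) *
    normal_pdf 0 (Num.sqrt (2 * c)^-1) x)).
  by apply: eq_Rintegral => x _; rewrite gauss_normal_pdf.
rewrite RintegralZl //; last exact: integrable_normal_pdf.
by rewrite /Rintegral integral_normal_pdf /= mulr1.
Qed.

Lemma expr_le_expR k x : 0 <= x -> x ^+ k <= k`!%:R * expR x.
Proof.
case: k => [|k] x0; first by rewrite mul1r -[leLHS]expR0 ler_expR.
rewrite mulrC -ler_pdivrMr ?ltr0n ?fact_gt0 //.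
by apply: le_trans (expR_ge1Dxn k x0); rewrite lerDr.
Qed.

(** Half of the Gaussian absorbs the power and the other half remains, which serves both
    integrability and decay at infinity. *)
Lemma powM_gauss_le c k : 0 < c -> exists2 M, 0 <= M &
  forall x, `|x ^+ k * gauss c x| <= M * gauss (c / 2) x.
Proof.
move=> c0; have c20 : 0 < c / 2 by rewrite divr_gt0.
(* From [|x|^k <= 1 + x^(2k)], the second summand being estimated by [y^k <= k! exp(y)] with
   [y = c x^2 / 2]. *)
exists (1 + (c / 2) ^- k * k`!%:R) => [|x].
  by rewrite addr_ge0 // mulr_ge0 // invr_ge0 exprn_ge0 // ltW.
have y0 : 0 <= c / 2 * x ^+ 2 by rewrite mulr_ge0 ?sqr_ge0 // ltW.
rewrite normrM (ger0_norm (gauss_ge0 _ _)) normrX.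
have -> : gauss c x = gauss (c / 2) x * gauss (c / 2) x.
  by rewrite /gauss -expRD; congr expR; field.
rewrite mulrA ler_wpM2r ?gauss_ge0 //.
have hx : `|x| ^+ k <= 1 + (x ^+ 2) ^+ k.
  have [x1|x1] := lerP `|x| 1.
    rewrite (le_trans (exprn_ile1 k (normr_ge0 x) x1)) // lerDl.
    by rewrite exprn_ge0 // sqr_ge0.
  rewrite -[x ^+ 2](real_normK (num_real x)) -exprM mulSn mul1n exprD.
  have xk1 : 1 <= `|x| ^+ k by rewrite exprn_ege1 // ltW.
  by rewrite ler_wpDl // ler_peMr // (le_trans _ xk1).
apply: le_trans (_ : (1 + (x ^+ 2) ^+ k) * gauss (c / 2) x <= _).
  by rewrite ler_wpM2r ?gauss_ge0.
rewrite mulrDl mul1r lerD //.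
  by rewrite gauss_le1 // ltW.
rewrite /gauss expRN ler_pdivrMr ?expR_gt0 // -[leRHS]mulrA.
by rewrite ler_pdivlMl ?exprn_gt0 // -exprMn expr_le_expR.
Qed.

Lemma continuous_powM_gauss c k : continuous (fun x => x ^+ k * gauss c x).
Proof.
by move=> x; apply: cvgM; [exact: exprn_continuous|exact: continuous_gauss].
Qed.

Lemma integrable_powM_gauss c k : 0 < c ->
  mu.-integrable setT (EFin \o (fun x => x ^+ k * gauss c x)).
Proof.
move=> c0; have [M M0 leM] := powM_gauss_le k c0.
have c20 : 0 < c / 2 by rewrite divr_gt0.
have mf : measurable_fun setT (fun x => x ^+ k * gauss c x).
  by apply: continuous_measurable_fun; exact: continuous_powM_gauss.
apply: le_integrable (integrableZl measurableT M (integrable_gauss c20)) => //.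
  exact/measurable_EFinP.
move=> x _ /=; rewrite lee_fin; apply: le_trans (leM x) _.
exact: ler_norm.
Qed.

Definition gauss_moment c k : R := \int[mu]_x (x ^+ k * gauss c x).

Lemma gauss_moment0 c : 0 < c -> gauss_moment c 0 = Num.sqrt (pi / c).
Proof.
move=> c0; rewrite -Rintegral_gauss //; apply: eq_Rintegral => x _.
by rewrite mul1r.
Qed.

Lemma cvg_powM_gauss c k (u : nat -> R) : 0 < c ->
  (forall n, `|u n| = n%:R) -> u n ^+ k * gauss c (u n) @[n --> \oo] --> 0.
Proof.
(* Bounding the power [k.+1] instead of [k] gains the factor [1 / n]. *)
move=> c0 un; have [M M0 leM] := powM_gauss_le k.+1 c0.
have bound n : `|u n.+1 ^+ k * gauss c (u n.+1)| <= M * n.+1%:R^-1.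
  rewrite ler_pdivlMr ?ltr0n // -(un n.+1) -normrM mulrAC -exprSr.
  apply: le_trans (leM _) _; rewrite ler_piMr //.
  by rewrite gauss_le1 // ltW // divr_gt0.
rewrite -cvg_shiftS /=; apply/norm_cvg0P.
apply: (@squeeze_cvgr _ _ _ _ (fun=> 0) (fun n => M * n.+1%:R^-1)).
- by apply: nearW => n; rewrite normr_ge0 bound.
- exact: cvg_cst.
- by rewrite -(mulr0 M); apply: cvgM; [exact: cvg_cst|exact: cvg_harmonic].
Qed.

(** The derivative of [x^k exp(- c x^2)] has integral zero. At [k = 0] this says that the first
    moment vanishes. *)
Lemma gauss_momentS c k : 0 < c ->
  2 * c * gauss_moment c k.+1 = k%:R * gauss_moment c k.-1.
Proof.
move=> c0.
pose F x := x ^+ k * gauss c x.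
pose f x := k%:R * (x ^+ k.-1 * gauss c x) -
  2 * c * (x ^+ k.+1 * gauss c x).
have i1 := integrable_powM_gauss k.-1 c0.
have i2 := integrable_powM_gauss k.+1 c0.
have i1' := integrableZl measurableT k%:R i1.
have i2' := integrableZl measurableT (2 * c) i2.
have f0 : (\int[mu]_x (f x)%:E = 0)%E.
  apply: (@integral_derive_eq0 F f).
  - move=> x.
    have := is_deriveM (is_deriveX k (is_derive_id x (1 : R)))
      (is_derive_gauss c x).
    rewrite (_ : id ^+ k * gauss c = F); last first.
      by apply/funext => y; rewrite !fctE.
    move=> d; apply: is_derive_eq d _.
    by rewrite !fctE /f /GRing.scale /= exprS; ring.
  - move=> x; apply: cvgB; apply: cvgM; try exact: cvg_cst;
      exact: continuous_powM_gauss.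
  - exact: integrableB i1' i2'.
  - by apply: cvg_powM_gauss => // n; rewrite ger0_norm.
  - by apply: cvg_powM_gauss => // n; rewrite normrN ger0_norm.
have : \int[mu]_x f x = 0 by rewrite /Rintegral f0.
rewrite RintegralB // !RintegralZl //.
by move/eqP; rewrite subr_eq0 => /eqP ->.
Qed.

End GaussianMoments.

(** * Integrals of products of functions in separate variables *)

Section IntegralProduct.
Context d1 d2 (T1 : measurableType d1) (T2 : measurableType d2) (R : realType).
Variables (m1 : {sigma_finite_measure set T1 -> \bar R}).
Variables (m2 : {sigma_finite_measure set T2 -> \bar R}).
Variables (f : T1 -> R) (g : T2 -> R).
Hypothesis intf : m1.-integrable setT (EFin \o f).
Hypothesis intg : m2.-integrable setT (EFin \o g).

Lemma integrable_prodM :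
  (m1 \x m2)%E.-integrable setT (EFin \o (fun p => f p.1 * g p.2)).
Proof.
have /measurable_EFinP mf := measurable_int _ intf.
have /measurable_EFinP mg := measurable_int _ intg.
have mfg : measurable_fun setT (EFin \o (fun p : T1 * T2 => f p.1 * g p.2)).
  apply/measurable_EFinP; apply: measurable_funM.
    by apply: (measurableT_comp mf); exact: measurable_fst.
  by apply: (measurableT_comp mg); exact: measurable_snd.
apply/(integrable12ltyP _ _ mfg) => /=.
have -> : (fun x => \int[m2]_y `|f x * g y|%:E)%E =
    (fun x => `|f x|%:E * \int[m2]_y `|g y|%:E)%E.
  apply/funext => x.
  under eq_integral do rewrite normrM EFinM.
  by rewrite integralZl //; exact: integrable_norm.
have fin : (\int[m2]_y `|g y|%:E \is a fin_num)%E.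
  by apply: integrable_fin_num => //; exact: integrable_norm.
rewrite -(fineK fin) integralZr //; last exact: integrable_norm.
rewrite fineK // lte_mul_pinfty //.
- by apply: integral_ge0 => x _; rewrite lee_fin.
- by apply: integrable_fin_num => //; exact: integrable_norm.
- by rewrite -ge0_fin_numE //; apply: integral_ge0 => x _; rewrite lee_fin.
Qed.

Lemma Rintegral_prodM :
  \int[(m1 \x m2)%E]_p (f p.1 * g p.2) =
  (\int[m1]_x f x) * (\int[m2]_y g y).
Proof.
rewrite {1}/Rintegral -(integral12_prod_meas1 integrable_prodM) /fubini_F /=.
have fing : (\int[m2]_y (g y)%:E \is a fin_num)%E by exact: integrable_fin_num.
have finf : (\int[m1]_y (f y)%:E \is a fin_num)%E by exact: integrable_fin_num.
under eq_integral do
  (under eq_integral do rewrite EFinM; rewrite integralZl //).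
by rewrite -(fineK fing) integralZr // fineM.
Qed.

End IntegralProduct.

(** * Gaussian integrals of polynomials on the plane *)

Section GaussianFunctional.
Context {R : realType}.
Local Notation C := R[i].
Local Notation Re := (@complex.Re R).
Local Notation Im := (@complex.Im R).
Local Notation mu := (@lebesgue_measure R).
Local Notation mu2 := (@lebesgue_measure R \x @lebesgue_measure R)%E.
Implicit Types (f g : C -> C) (c z : C) (a b : nat).

(** Monomials in the real coordinates, because their Gaussian integrals factor into one-dimensional
    moments. *)
Inductive polyfun : (C -> C) -> Prop :=
| polyfun_mono c a b :
    polyfun (fun z => c * (Re z ^+ a * Im z ^+ b)%:C)
| polyfunD f g : polyfun f -> polyfun g -> polyfun (fun z => f z + g z).

Lemma polyfun_cst c : polyfun (fun=> c).
Proof.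
rewrite (_ : (fun=> c) = fun z => c * (Re z ^+ 0 * Im z ^+ 0)%:C).
  exact: polyfun_mono.
by apply/funext => z; rewrite !expr0 mulr1 rmorph1 mulr1.
Qed.

Lemma polyfunM f g : polyfun f -> polyfun g -> polyfun (fun z => f z * g z).
Proof.
move=> pf pg; elim: pf => [c a b|f1 f2 _ pf1 _ pf2]; last first.
  rewrite (_ : (fun z => _) = fun z => f1 z * g z + f2 z * g z).
    exact: polyfunD.
  by apply/funext => z; rewrite mulrDl.
elim: pg => [c' a' b'|g1 g2 _ pg1 _ pg2]; last first.
  rewrite (_ : (fun z => _) = fun z => c * (Re z ^+ a * Im z ^+ b)%:C * g1 z +
    c * (Re z ^+ a * Im z ^+ b)%:C * g2 z); first exact: polyfunD.
  by apply/funext => z; rewrite mulrDr.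
rewrite (_ : (fun z => _) =
    fun z => c * c' * (Re z ^+ (a + a') * Im z ^+ (b + b'))%:C).
  exact: polyfun_mono.
by apply/funext => z; rewrite !exprD; ring.
Qed.

Lemma polyfunX f a : polyfun f -> polyfun (fun z => f z ^+ a).
Proof.
move=> pf; elim: a => [|a IHa]; first exact: polyfun_cst.
rewrite (_ : (fun z => _) = fun z => f z * f z ^+ a).
  exact: polyfunM.
by apply/funext => z; rewrite exprS.
Qed.

Lemma complex_i (x y : R) : x +i* y = x%:C + 'i * y%:C.
Proof. exact: (complexE (x +i* y)). Qed.

Lemma polyfun_id : polyfun id.
Proof.
rewrite (_ : id = fun z => 1 * (Re z ^+ 1 * Im z ^+ 0)%:C +
                           'i * (Re z ^+ 0 * Im z ^+ 1)%:C).
  by apply: polyfunD; exact: polyfun_mono.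
by apply/funext => -[x y]; rewrite [LHS]complex_i !expr0 mulr1 !mul1r.
Qed.

Lemma polyfun_conj : polyfun (fun z => z^*).
Proof.
rewrite (_ : (fun z => _) = fun z => 1 * (Re z ^+ 1 * Im z ^+ 0)%:C +
                                     - 'i * (Re z ^+ 0 * Im z ^+ 1)%:C).
  by apply: polyfunD; exact: polyfun_mono.
apply/funext => -[x y]; rewrite [LHS](complex_i x (- y)) !expr0 mulr1 !mul1r.
by rewrite rmorphN mulrN mulNr.
Qed.

Variable nu : R.
Hypothesis nu_gt0 : 0 < nu.

Definition gweight (p : R * R) : R := gauss nu p.1 * gauss nu p.2.

Definition gauss_functional f : C :=
  (\int[mu2]_p (Re (f (p.1 +i* p.2)) * gweight p)) +i*
  (\int[mu2]_p (Im (f (p.1 +i* p.2)) * gweight p)).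

Lemma integrable_mono_gweight a b :
  mu2.-integrable setT
    (EFin \o (fun p => p.1 ^+ a * gauss nu p.1 * (p.2 ^+ b * gauss nu p.2))).
Proof.
exact (integrable_prodM (integrable_powM_gauss a nu_gt0)
  (integrable_powM_gauss b nu_gt0)).
Qed.

Lemma Rintegral_mono_gweight (r : R) a b :
  \int[mu2]_p (r * (p.1 ^+ a * gauss nu p.1 * (p.2 ^+ b * gauss nu p.2))) =
  r * (gauss_moment nu a * gauss_moment nu b).
Proof.
rewrite RintegralZl //; last exact: integrable_mono_gweight.
congr (_ * _).
exact: (Rintegral_prodM (integrable_powM_gauss a nu_gt0)
  (integrable_powM_gauss b nu_gt0)).
Qed.

Lemma integrable_polyfun f : polyfun f ->
  mu2.-integrable setT (EFin \o (fun p => Re (f (p.1 +i* p.2)) * gweight p)) /\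
  mu2.-integrable setT (EFin \o (fun p => Im (f (p.1 +i* p.2)) * gweight p)).
Proof.
elim => [c a b|f1 f2 _ [r1 i1] _ [r2 i2]].
  have i := integrable_mono_gweight a b; split.
    rewrite (_ : _ \o _ = fun p => (Re c)%:E * (EFin \o (fun q : R * R =>
        q.1 ^+ a * gauss nu q.1 * (q.2 ^+ b * gauss nu q.2))%R) p)%E.
      exact: integrableZl.
    apply/funext => p; rewrite /= -EFinM; congr EFin.
    by rewrite Re_mulc /= mulr0 subr0 /gweight; ring.
  rewrite (_ : _ \o _ = fun p => (Im c)%:E * (EFin \o (fun q : R * R =>
      q.1 ^+ a * gauss nu q.1 * (q.2 ^+ b * gauss nu q.2))%R) p)%E.
    exact: integrableZl.
  apply/funext => p; rewrite /= -EFinM; congr EFin.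
  by rewrite Im_mulc /= mulr0 add0r /gweight; ring.
split.
  rewrite (_ : _ \o _ = fun p => (Re (f1 (p.1 +i* p.2)) * gweight p)%:E +
     (Re (f2 (p.1 +i* p.2)) * gweight p)%:E)%E; first exact: integrableD.
  by apply/funext => p; rewrite /= -EFinD -mulrDl Re_addc.
rewrite (_ : _ \o _ = fun p => (Im (f1 (p.1 +i* p.2)) * gweight p)%:E +
   (Im (f2 (p.1 +i* p.2)) * gweight p)%:E)%E; first exact: integrableD.
by apply/funext => p; rewrite /= -EFinD -mulrDl Im_addc.
Qed.

Lemma gauss_functional_mono c a b :
  gauss_functional (fun z => c * (Re z ^+ a * Im z ^+ b)%:C) =
  c * (gauss_moment nu a * gauss_moment nu b)%:C.
Proof.
apply: complex_eq; rewrite ?Re_mulc ?Im_mulc /= !mulr0 ?subr0 ?add0r;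
  rewrite -Rintegral_mono_gweight; apply: eq_Rintegral => p _.
  by rewrite Re_mulc /= mulr0 subr0 /gweight; ring.
by rewrite Im_mulc /= mulr0 add0r /gweight; ring.
Qed.

Lemma gauss_functionalD f g : polyfun f -> polyfun g ->
  gauss_functional (fun z => f z + g z) =
  gauss_functional f + gauss_functional g.
Proof.
move=> /integrable_polyfun[rf jf] /integrable_polyfun[rg jg].
apply: complex_eq; rewrite ?Re_addc ?Im_addc /= -RintegralD //;
  apply: eq_Rintegral => p _; rewrite -mulrDl.
  by rewrite Re_addc.
by rewrite Im_addc.
Qed.

Lemma gauss_functionalZ c f : polyfun f ->
  gauss_functional (fun z => c * f z) = c * gauss_functional f.
Proof.
elim => [c' a b|f1 f2 p1 IH1 p2 IH2].
  rewrite gauss_functional_mono mulrA -gauss_functional_mono.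
  by congr gauss_functional; apply/funext => z; rewrite mulrA.
rewrite gauss_functionalD // mulrDr -IH1 -IH2 -gauss_functionalD.
- by congr gauss_functional; apply/funext => z; rewrite mulrDr.
- exact: polyfunM (polyfun_cst c) p1.
- exact: polyfunM (polyfun_cst c) p2.
Qed.

Lemma wirtinger_Re z : wirtinger (fun w => (Re w)%:C) z (1 / 2) (1 / 2).
Proof.
rewrite (_ : (fun w => _) = fun w => 1 / 2 * (w + w^*)).
  have d := wirtingerD (wirtinger_id z) (wirtinger_conj z).
  by apply: wirtinger_eq (wirtingerZ (1 / 2) d) _ _; ring.
by apply/funext => w; rewrite (ReJ_add w) mulrC mul1r.
Qed.

Lemma wirtinger_Im z : wirtinger (fun w => (Im w)%:C) z (- 'i / 2) ('i / 2).
Proof.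
rewrite (_ : (fun w => _) = fun w => 'i / 2 * (w^* + -1 * w)).
  have d := wirtingerD (wirtinger_conj z) (wirtingerZ (-1) (wirtinger_id z)).
  by apply: wirtinger_eq (wirtingerZ ('i / 2) d) _ _; ring.
by apply/funext => w; rewrite (ImJ_sub w) mulN1r [LHS]mulrC mulrAC mulrA.
Qed.

(* On monomials this is the recursion for the Gaussian moments. *)
Lemma stein_polyfun f : polyfun f ->
  exists u v : C -> C, [/\ forall z, wirtinger f z (u z) (v z), polyfun v &
    gauss_functional v = nu%:C * gauss_functional (fun z => z * f z)].
Proof.
elim => [c k l|f1 f2 p1 [a1 [b1 [d1 q1 e1]]] p2 [a2 [b2 [d2 q2 e2]]]].
  pose g1 z := (Re z ^+ k.-1 * Im z ^+ l)%:C.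
  pose g2 z := (Re z ^+ k * Im z ^+ l.-1)%:C.
  exists (fun z => c * k%:R / 2 * g1 z + - (c * 'i * l%:R / 2) * g2 z).
  exists (fun z => c * k%:R / 2 * g1 z + c * 'i * l%:R / 2 * g2 z).
  split.
  - move=> z.
    rewrite (_ : (fun w => _) = fun w => c * ((Re w)%:C ^+ k * (Im w)%:C ^+ l)).
      have d := wirtingerM (wirtingerX k (wirtinger_Re z))
        (wirtingerX l (wirtinger_Im z)).
      apply: wirtinger_eq (wirtingerZ c d) _ _;
        by rewrite /g1 /g2 !rmorphM !rmorphXn; field.
    by apply/funext => w; rewrite rmorphM !rmorphXn.
  - by apply: polyfunD; exact: polyfun_mono.
  - rewrite gauss_functionalD; try exact: polyfun_mono.
    rewrite !gauss_functional_mono.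
    rewrite (_ : (fun z => _) = fun z =>
        c * (Re z ^+ k.+1 * Im z ^+ l)%:C +
        c * 'i * (Re z ^+ k * Im z ^+ l.+1)%:C).
      rewrite gauss_functionalD; try exact: polyfun_mono.
      rewrite !gauss_functional_mono.
      have := congr1 (real_complex R) (gauss_momentS k nu_gt0).
      have := congr1 (real_complex R) (gauss_momentS l nu_gt0).
      rewrite !rmorphM !rmorph_nat => el ek.
      transitivity (c / 2 * (k%:R * (gauss_moment nu k.-1)%:C) *
          (gauss_moment nu l)%:C + c * 'i / 2 * (gauss_moment nu k)%:C *
          (l%:R * (gauss_moment nu l.-1)%:C)); first by ring.
      by rewrite -el -ek; field.
    apply/funext => z; rewrite -{1}(complex_etaE z) complex_i !exprS.
    by rewrite !rmorphM; ring.
exists (fun z => a1 z + a2 z), (fun z => b1 z + b2 z); split.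
- by move=> z; exact: wirtingerD.
- exact: polyfunD.
- rewrite gauss_functionalD // e1 e2 -mulrDr -gauss_functionalD.
  + by congr (_ * gauss_functional _); apply/funext => z; rewrite mulrDr.
  + exact: polyfunM polyfun_id p1.
  + exact: polyfunM polyfun_id p2.
Qed.

(** Integration by parts: [dzbar] of the weight is [- nu z] times the weight. *)
Lemma gauss_functional_dzbar f : polyfun f ->
  gauss_functional (dzbar f) = nu%:C * gauss_functional (fun z => z * f z).
Proof.
move=> /stein_polyfun[a [b [df _ <-]]]; congr gauss_functional.
by apply/funext => z; exact: wirtinger_dzbar (df z).
Qed.

End GaussianFunctional.

(** * Norms of the Hermite polynomials *)

Section HermiteNorm.
Context {R : realType}.
Local Notation C := R[i].
Local Notation mu2 := (@lebesgue_measure R \x @lebesgue_measure R)%E.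
Variable nu : R.
Hypothesis nu_gt0 : 0 < nu.
Implicit Types (z : C) (m n : nat).

(** Conjugation exchanges the recursions in [m] and in [n]. *)
Lemma conj_hermite_poly m n z :
  (hermite_poly nu m n z)^* = hermite_poly nu n m z.
Proof.
have nuJ : (nu%:C)^* = nu%:C by exact: conjc_real.
elim: m n => [|m IHm] n.
  rewrite hermite_poly0 rmorphXn rmorphM /= nuJ conjCK.
  elim: n => [|n IHn] //; rewrite hermite_polySl -IHn mulr0n.
  by rewrite exprS; ring.
rewrite hermite_polySl hermite_polySr rmorphB !rmorphM /= nuJ.
by rewrite !IHm rmorph_nat.
Qed.

Lemma polyfun_hermite_poly m n : polyfun (hermite_poly nu m n).
Proof.
elim: m n => [|m IHm] n.
  apply: polyfunX; apply: polyfunM polyfun_conj; exact: polyfun_cst.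
rewrite (_ : hermite_poly nu m.+1 n = fun z =>
    nu%:C * z * hermite_poly nu m n z +
    - (nu%:C * n%:R) * hermite_poly nu m n.-1 z).
  apply: polyfunD; apply: polyfunM => //; last exact: polyfun_cst.
  by apply: polyfunM polyfun_id; exact: polyfun_cst.
by apply/funext => z; rewrite hermite_polySl mulNr.
Qed.

(** The squared norm: the second factor is the conjugate of the first, written as a Hermite
    polynomial so that its Wirtinger derivatives are at hand. *)
Let hermite_sqnorm m n : C := gauss_functional nu
  (fun z => hermite_poly nu m n z * hermite_poly nu n m z).

Let hermite_sqnormC m n : hermite_sqnorm m n = hermite_sqnorm n m.
Proof.
by congr gauss_functional; apply/funext => z; rewrite mulrC.
Qed.

(** Integration by parts is applied to [h = H_{m,n} H_{n,m+1}]. Of the two terms of [dzbar h], the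
    one with [H_{m,n-1}] cancels the lower term in the recursion for [H_{m+1,n}]. *)
Let hermite_sqnormS m n :
  hermite_sqnorm m.+1 n = nu%:C * m.+1%:R * hermite_sqnorm m n.
Proof.
pose h z := hermite_poly nu m n z * hermite_poly nu n m.+1 z.
pose h1 z := hermite_poly nu m n.-1 z * hermite_poly nu n m.+1 z.
pose h2 z := hermite_poly nu m n z * hermite_poly nu n m z.
have ph : polyfun h by apply: polyfunM; exact: polyfun_hermite_poly.
have ph1 : polyfun h1 by apply: polyfunM; exact: polyfun_hermite_poly.
have ph2 : polyfun h2 by apply: polyfunM; exact: polyfun_hermite_poly.
have := gauss_functional_dzbar nu_gt0 ph.
have -> : dzbar h = fun z => nu%:C * n%:R * h1 z + nu%:C * m.+1%:R * h2 z.
  apply/funext => z.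
  rewrite (wirtinger_dzbar (wirtingerM (wirtinger_hermite_poly nu m n z)
    (wirtinger_hermite_poly nu n m.+1 z))).
  by rewrite /h1 /h2 /=; ring.
have pc c f : polyfun f -> polyfun (fun z => c * f z).
  exact: polyfunM (polyfun_cst c).
rewrite gauss_functionalD ?(gauss_functionalZ nu_gt0) //; try exact: pc.
rewrite -/(hermite_sqnorm m n) => e.
rewrite /hermite_sqnorm (_ : (fun z => _) =
    fun z => nu%:C * (z * h z) + - (nu%:C * n%:R) * h1 z); last first.
  by apply/funext => z; rewrite hermite_polySl /h /h1; ring.
rewrite gauss_functionalD ?(gauss_functionalZ nu_gt0) //.
- by rewrite -/(hermite_sqnorm m n) -e; ring.
- exact: polyfunM polyfun_id ph.
- by apply/pc/polyfunM => //; exact: polyfun_id.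
- exact: pc.
Qed.

Lemma gauss_functional_hermite_poly m n :
  gauss_functional nu (fun z => hermite_poly nu m n z * hermite_poly nu n m z)
  = (pi / nu * nu ^+ (m + n) * m`!%:R * n`!%:R)%:C.
Proof.
rewrite -/(hermite_sqnorm m n).
elim: m => [|m IHm].
  (* Symmetry brings [n] to the front, so the same recursion removes it; what remains is the total
     mass [pi / nu]. *)
  rewrite hermite_sqnormC; elim: n => [|n IHn].
    rewrite /hermite_sqnorm (_ : (fun z => _) = fun z =>
        1 * (complex.Re z ^+ 0 * complex.Im z ^+ 0)%:C); last first.
      by apply/funext => z; rewrite hermite_poly0 !expr0 !mulr1.
    rewrite gauss_functional_mono // mul1r gauss_moment0 // -expr2.
    by rewrite sqr_sqrtr ?divr_ge0 ?pi_ge0 ?(ltW nu_gt0) // expr0 !mulr1.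
  rewrite hermite_sqnormS IHn -(rmorph_nat (real_complex R)) -!rmorphM.
  by congr (_%:C); rewrite add0n factS natrM exprS; ring.
rewrite hermite_sqnormS IHm -(rmorph_nat (real_complex R)) -!rmorphM.
by congr (_%:C); rewrite addSn factS natrM exprS; ring.
Qed.

Lemma sqr_normc_complex z : (Normc.normc z ^+ 2)%:C = z * z^*.
Proof. by rewrite -normCK rmorphXn. Qed.

Lemma L2norm_hermite m n : L2norm nu (hermite nu m n) ^+ 2 =
  pi / nu * nu ^+ (m + n) * m`!%:R * n`!%:R.
Proof.
have := congr1 (@complex.Re R) (gauss_functional_hermite_poly m n).
rewrite /gauss_functional /= hermiteE /L2norm => <-.
rewrite sqr_sqrtr; last first.
  apply: Rintegral_ge0 => p _.
  by rewrite mulr_ge0 ?expR_ge0 // sqr_ge0.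
apply: eq_Rintegral => p _; congr (_ * _).
  by rewrite -(conj_hermite_poly m n) -sqr_normc_complex.
rewrite /gweight /gauss -expRD; congr expR.
by rewrite sqr_sqrtr ?addr_ge0 ?sqr_ge0 //; ring.
Qed.

Lemma L2norm_hermite_gt0 m n : 0 < L2norm nu (hermite nu m n).
Proof.
rewrite lt_def sqrtr_ge0 andbT; apply/eqP => e.
have := L2norm_hermite m n; rewrite e expr0n /= => /esym/eqP.
by rewrite gt_eqF // !mulr_gt0 ?invr_gt0 ?pi_gt0 ?exprn_gt0 //
  ltr0n fact_gt0.
Qed.

(** Positivity of the norm replaces the search for a point: the zero function has norm zero. *)
Lemma hermite_neq0 m n : exists z, hermite nu m n z != 0.
Proof.
apply: contrapT => h0; have := L2norm_hermite_gt0 m n.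
have -> : hermite nu m n = fun=> 0.
  apply/funext => z; apply/eqP; apply: contrapT => /negP hz.
  by apply: h0; exists z.
suff -> : L2norm nu (fun=> 0) = 0 by rewrite ltxx.
rewrite /L2norm -[RHS]sqrtr0; congr Num.sqrt.
rewrite -[RHS](mul0r (fine (mu2 setT))) -Rintegral_cst //.
by apply: eq_Rintegral => p _; rewrite Normc.normc0 expr0n mul0r.
Qed.

End HermiteNorm.

(** * Sums over the net of finite subsets *)

Section UnconditionalSums.
Local Open Scope classical_set_scope.
#[local] Existing Instance totally_filter.

(** The same limit as in [is_heat_kernel], to which it unfolds by conversion. *)
Definition has_sum (I : choiceType) (K : numFieldType) (f : I -> K) (s : K) :=
  partial_sum f @ totally --> (s : K^o).

Section Generic.
Context {K : numFieldType}.
Implicit Types I J : choiceType.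

Lemma partial_sumE I (f : I -> K) (A : {fset I}) :
  partial_sum f A = \sum_(i <- A) f i.
Proof. by rewrite big_seq_fsetE. Qed.

Lemma has_sumP I (f : I -> K) s : has_sum f s <->
  forall e : K, 0 < e -> exists A : {fset I}, forall B : {fset I},
    (A `<=` B)%fset -> `|s - \sum_(i <- B) f i| < e.
Proof.
split=> [/cvgrPdist_lt fs e e0|fs].
  have [A _ AP] := fs e e0.
  by exists A => B /AP /=; rewrite partial_sumE.
apply/cvgrPdist_lt => e /fs [A AP].
by exists A => // B /AP; rewrite /= partial_sumE.
Qed.

Lemma has_sum_unique I (f : I -> K) s t : has_sum f s -> has_sum f t -> s = t.
Proof. by move=> fs ft; exact: (cvg_unique (@norm_hausdorff _ K^o) fs ft). Qed.

Lemma has_sumD I (f g : I -> K) s t : has_sum f s -> has_sum g t ->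
  has_sum (fun i => f i + g i) (s + t).
Proof.
move=> fs gt; rewrite /has_sum (_ : partial_sum _ = fun A =>
    (partial_sum f A : K^o) + partial_sum g A); first exact: cvgD.
by apply/funext => A; rewrite !partial_sumE big_split.
Qed.

Lemma has_sumZ I c (f : I -> K) s : has_sum f s ->
  has_sum (fun i => c * f i) (c * s).
Proof.
move=> fs; rewrite /has_sum (_ : partial_sum _ = fun A =>
    (c : K^o) * partial_sum f A); first by apply: cvgM fs; exact: cvg_cst.
by apply/funext => A; rewrite !partial_sumE mulr_sumr.
Qed.

Arguments has_sumZ {I} c {f s}.

Lemma has_sumB I (f g : I -> K) s t : has_sum f s -> has_sum g t ->
  has_sum (fun i => f i - g i) (s - t).
Proof.
move=> fs /(has_sumZ (-1)) gt; rewrite -mulN1r.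
rewrite (_ : (fun i => _) = fun i => f i + -1 * g i); first exact: has_sumD.
by apply/funext => i; rewrite mulN1r.
Qed.

Lemma has_sum0 I : has_sum (fun _ : I => 0 : K) 0.
Proof.
apply/has_sumP => e e0; exists fset0 => B _.
by rewrite big1 // subrr normr0.
Qed.

Lemma has_sum_sum I J (r : seq J) (f : J -> I -> K) (s : J -> K) :
  (forall j, has_sum (f j) (s j)) ->
  has_sum (fun i => \sum_(j <- r) f j i) (\sum_(j <- r) s j).
Proof.
move=> fs; elim: r => [|j r IHr].
  rewrite big_nil (_ : (fun i => _) = fun=> 0); first exact: has_sum0.
  by apply/funext => i; rewrite big_nil.
rewrite big_cons (_ : (fun i => _) = fun i => f j i + \sum_(k <- r) f k i).
  exact: has_sumD.
by apply/funext => i; rewrite big_cons.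
Qed.

Lemma fsubset_iota (A : {fset nat}) n :
  (\max_(i <- A) i < n)%N -> (A `<=` [fset i in iota 0 n])%fset.
Proof.
move=> ltn; apply/fsubsetP => i iA; rewrite inE mem_iota add0n /=.
apply: leq_ltn_trans ltn.
exact: (@leq_bigmax_seq _ _ xpredT (fun j : nat => j)).
Qed.

Lemma sum_fset_iota (f : nat -> K) n :
  \sum_(i <- [fset i in iota 0 n]%fset) f i = \sum_(i < n) f i.
Proof.
rewrite -(big_mkord xpredT f) /index_iota subn0; apply: perm_big.
apply: uniq_perm; rewrite ?fset_uniq ?iota_uniq // => i.
by rewrite inE.
Qed.

Lemma has_sum_finite (f : nat -> K) n : (forall i, (n <= i)%N -> f i = 0) ->
  has_sum f (\sum_(i < n) f i).
Proof.
move=> f0; apply/has_sumP => e e0.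
exists [fset i in iota 0 n]%fset => B /fsubsetP AB.
rewrite (_ : \sum_(i <- B) f i = \sum_(i < n) f i) ?subrr ?normr0 //.
rewrite -(big_fset_incl _ (A := [fset i in iota 0 n]%fset)).
- exact: sum_fset_iota.
- exact/fsubsetP.
- by move=> i _; rewrite inE mem_iota /= add0n -leqNgt => /f0.
Qed.

Lemma has_sum_nat_recl (f : nat -> K) s :
  has_sum (fun n => f n.+1) s -> has_sum f (f 0%N + s).
Proof.
move=> /has_sumP fs; apply/has_sumP => e /fs[A AP].
exists (0%N |` [fset n.+1 | n in A])%fset => B.
rewrite fsubUset fsub1set => /andP[B0 /fsubsetP AB].
pose B' := [fset n.-1 | n in (B `\ 0%N)]%fset.
have predB : {in (B `\ 0%N)%fset &, injective predn}.
  by move=> [|m] [|n] //=; rewrite !inE //= => _ _ ->.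
have /AP : (A `<=` B')%fset.
  apply/fsubsetP => n nA; apply/imfsetP; exists n.+1 => //=.
  by rewrite !inE /=; apply: AB; apply/imfsetP; exists n.
rewrite /B' big_imfset //= (big_fsetD1 0%N B0) opprD addrACA subrr add0r.
rewrite (_ : \sum_(n <- (B `\ 0%N)%fset) f n.-1.+1 =
  \sum_(n <- (B `\ 0%N)%fset) f n) //.
by apply: eq_fbigr => -[|n] //; rewrite !inE.
Qed.

Lemma has_sum_cvgn (f : nat -> K) s : has_sum f s ->
  (\sum_(i < n) f i) @[n --> \oo] --> (s : K^o).
Proof.
move=> /has_sumP fs; apply/cvgrPdist_lt => e /fs[A AP].
near=> n.
rewrite -sum_fset_iota; apply/AP/fsubset_iota.
by near: n; exact: nbhs_infty_gt.
Unshelve. all: by end_near. Qed.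

Lemma has_sum_bij I J (h : I -> J) (h' : J -> I) (f : J -> K) s :
  cancel h h' -> cancel h' h -> has_sum f s -> has_sum (f \o h) s.
Proof.
move=> hK h'K /has_sumP fs; apply/has_sumP => e /fs[A AP].
exists (h' @` A)%fset => B /fsubsetP AB.
have /AP : (A `<=` h @` B)%fset.
  apply/fsubsetP => j jA; apply/imfsetP; exists (h' j) => //=.
  by apply: AB; apply/imfsetP; exists j.
by rewrite big_imfset //= => x y _ _; exact: can_inj hK _ _.
Qed.

Lemma big_fsetM I J (A : {fset I}) (B : {fset J}) (f : I * J -> K) :
  \sum_(p <- (A `*` B)%fset) f p = \sum_(i <- A) \sum_(j <- B) f (i, j).
Proof.
rewrite -big_allpairs; apply: perm_big.
apply: uniq_perm; rewrite ?fset_uniq //.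
  by rewrite allpairs_uniq ?fset_uniq // => -[? ?] [? ?].
move=> p; rewrite in_fsetM; apply/andP/allpairsP => [[? ?]|[q [qA qB ->]]] //.
by exists p; split=> //; exact: surjective_pairing.
Qed.

(** A large finite set is taken as a product [B * B']. Only the finitely many rows in [B] matter, so
    [has_sum_sum] yields one [B'] at which the sum of all these rows is within [e / 2]. *)
Lemma has_sum_rows I J (f : I * J -> K) (g : I -> K) s : has_sum f s ->
  (forall i, has_sum (fun j => f (i, j)) (g i)) -> has_sum g s.
Proof.
move=> /has_sumP fs fg; apply/has_sumP => e e0.
have e20 : 0 < e / 2 by rewrite divr_gt0.
have [A AP] := fs _ e20.
exists [fset p.1 | p in A]%fset => B /fsubsetP AB.
have /has_sumP/(_ _ e20)[A' A'P] := has_sum_sum (r := enum_fset B) fg.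
pose B' := (A' `|` [fset p.2 | p in A])%fset.
have /AP : (A `<=` B `*` B')%fset.
  apply/fsubsetP => p pA; rewrite in_fsetM AB ?in_fsetU; last first.
    by apply/imfsetP; exists p.
  by apply/orP; right; apply/imfsetP; exists p.
rewrite big_fsetM exchange_big /= => lt1.
have /A'P lt2 : (A' `<=` B')%fset by exact: fsubsetUl.
rewrite (splitr e) -(subrKA (\sum_(j <- B') \sum_(i <- B) f (i, j))).
apply: le_lt_trans (ler_normD _ _) _.
by rewrite ltrD // distrC.
Qed.

Lemma has_sum_cols I J (f : I * J -> K) (g : J -> K) s : has_sum f s ->
  (forall j, has_sum (fun i => f (i, j)) (g j)) -> has_sum g s.
Proof.
move=> /(has_sum_bij (h := fun p : J * I => (p.2, p.1))
  (h' := fun p : I * J => (p.2, p.1))) fs fg.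
by apply: (has_sum_rows (fs _ _)) => [[]|[]|].
Qed.

Lemma ler_sum_fset I (f : I -> K) (A B : {fset I}) : (forall i, 0 <= f i) ->
  (A `<=` B)%fset -> \sum_(i <- A) f i <= \sum_(i <- B) f i.
Proof.
move=> f0 AB; rewrite [leRHS](big_fsetID _ (mem A)) /=.
rewrite (_ : \sum_(i <- [fset x in B | mem A x]%fset) f i = \sum_(i <- A) f i).
  by rewrite lerDl sumr_ge0.
apply: eq_fbigl => i; rewrite !inE /= andbC.
by case: (boolP (i \in A)) => //= /(fsubsetP AB) ->.
Qed.

Lemma sum_fset_le_nat (f : nat -> K) M : (forall n, 0 <= f n) ->
  (forall n, \sum_(i < n) f i <= M) ->
  forall A : {fset nat}, \sum_(i <- A) f i <= M.
Proof.
move=> f0 fM A; have AN := fsubset_iota (ltnSn (\max_(i <- A) i)).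
by apply: (le_trans (ler_sum_fset f0 AN)); rewrite sum_fset_iota.
Qed.

(** With nonnegative terms, a finite set may be enlarged to the product of its projections. *)
Lemma sum_fset_le_rows I J (f : I * J -> K) (r : I -> K) M :
  (forall p, 0 <= f p) ->
  (forall i (B : {fset J}), \sum_(j <- B) f (i, j) <= r i) ->
  (forall A : {fset I}, \sum_(i <- A) r i <= M) ->
  forall A : {fset I * J}, \sum_(p <- A) f p <= M.
Proof.
move=> f0 fr rM A.
pose A1 := [fset p.1 | p in A]%fset; pose A2 := [fset p.2 | p in A]%fset.
have AA : (A `<=` A1 `*` A2)%fset.
  apply/fsubsetP => p pA; rewrite in_fsetM.
  by apply/andP; split; apply/imfsetP; exists p.
apply: le_trans (ler_sum_fset f0 AA) _; rewrite big_fsetM.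
by apply: le_trans (rM A1); apply: ler_sum => i _; exact: fr.
Qed.

End Generic.
#[global] Arguments has_sumZ {K I} c {f s}.

Section Real.
Context {R : realType}.
Implicit Types I : choiceType.

Lemma has_sum_ge0_le I (f : I -> R) s : (forall i, 0 <= f i) -> has_sum f s ->
  forall A : {fset I}, \sum_(i <- A) f i <= s.
Proof.
move=> f0 fs A; apply: (cvgr_to_ge fs); exists A => // B /= AB.
by rewrite partial_sumE ler_sum_fset.
Qed.

Lemma has_sum_ge0_bounded I (f : I -> R) M : (forall i, 0 <= f i) ->
  (forall A : {fset I}, \sum_(i <- A) f i <= M) -> exists s, has_sum f s.
Proof.
move=> f0 fM; pose S := [set \sum_(i <- A) f i | A in [set: {fset I}]].
have supS : has_sup S.
  by split; [exists (\sum_(i <- fset0) f i), fset0|exists M => _ [A _ <-]].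
exists (sup S); apply/has_sumP => e e0.
have [_ [A _ <-] ltA] := sup_adherent e0 supS.
exists A => B AB.
have leB : \sum_(i <- B) f i <= sup S.
  by apply: sup_ubound; [case: supS|exists B].
rewrite ger0_norm ?subr_ge0 // ltrBlDr -ltrBlDl.
by apply: lt_le_trans ltA _; exact: ler_sum_fset.
Qed.

(** Both [f + b] and [b] have nonnegative terms and bounded sums; [f] is their difference. *)
Lemma has_sum_dominated I (f b : I -> R) M : (forall i, `|f i| <= b i) ->
  (forall A : {fset I}, \sum_(i <- A) b i <= M) -> exists s, has_sum f s.
Proof.
move=> fb bM.
have [||s fbs] := @has_sum_ge0_bounded I (fun i => f i + b i) (M + M).
- move=> i; rewrite -lerBlDr sub0r.
  by have /ler_normlP[] := fb i; rewrite lerNl.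
- move=> A; rewrite big_split lerD //; apply: le_trans (bM A).
  by apply: ler_sum => i _; apply: le_trans (fb i); exact: ler_norm.
have [||t bt] := @has_sum_ge0_bounded I b M => //.
  by move=> i; exact: le_trans (fb i).
exists (s - t); rewrite (_ : f = fun i => f i + b i - b i).
  exact: has_sumB.
by apply/funext => i; rewrite addrK.
Qed.

End Real.

Section Complex.
Context {R : realType}.
Local Notation C := R[i].
Implicit Types I : choiceType.

Lemma has_sum_real_complex I (f : I -> R) s :
  has_sum f s -> has_sum (fun i => (f i)%:C) s%:C.
Proof.
move=> /has_sumP fs; apply/has_sumP => e e0.
(* A positive element of [C] is real, so its real part serves as the tolerance. *)
have eE : (complex.Re e)%:C = e by apply: RRe_real; exact: gtr0_real.
have := e0; rewrite -eE ltcR => /fs[A AP].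
exists A => B /AP lte.
rewrite -rmorph_sum -rmorphB normc_def /= expr0n addr0 sqrtr_sqr.
by rewrite ltcR.
Qed.

Lemma has_sum_Re I (f : I -> C) s :
  has_sum f s -> has_sum (fun i => complex.Re (f i)) (complex.Re s).
Proof.
move=> /has_sumP fs; apply/has_sumP => e e0.
have /fs[A AP] : 0 < e%:C by rewrite ltcR.
exists A => B /AP lte; rewrite -ltcR; apply: le_lt_trans lte.
have -> : \sum_(i <- B) complex.Re (f i) = complex.Re (\sum_(i <- B) f i).
  elim: (enum_fset B) => [|i r IHr]; first by rewrite !big_nil.
  by rewrite !big_cons IHr Re_addc.
rewrite -[X in X - _]/(complex.Re s).
have -> x y : complex.Re x - complex.Re y = complex.Re (x - y) :> R.
  by case: x y => ? ? [].
exact: normc_ge_Re.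
Qed.

Lemma has_sum_Im I (f : I -> C) s :
  has_sum f s -> has_sum (fun i => complex.Im (f i)) (complex.Im s).
Proof.
move=> /(has_sumZ (- 'i))/has_sum_Re.
have ReNi z : complex.Re (- 'i * z) = complex.Im z :> R.
  by case: z => x y; rewrite Re_mulc /= oppr0 mul0r mulN1r opprK add0r.
by rewrite ReNi; under eq_fun do rewrite ReNi.
Qed.

Lemma normc_ge_Im (z : C) : `|complex.Im z|%:C <= `|z|.
Proof.
case: z => x y; rewrite normc_def lecR -sqrtr_sqr ler_wsqrtr //=.
by rewrite lerDr sqr_ge0.
Qed.

Lemma has_sum_dominatedC I (f : I -> C) (b : I -> R) M :
  (forall i, `|f i| <= (b i)%:C) ->
  (forall A : {fset I}, \sum_(i <- A) b i <= M) -> exists s, has_sum f s.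
Proof.
move=> fb bM.
have [||x fx] := @has_sum_dominated _ I (fun i => complex.Re (f i)) b M => //.
  by move=> i; rewrite -lecR; apply: le_trans (fb i); exact: normc_ge_Re.
have [||y fy] := @has_sum_dominated _ I (fun i => complex.Im (f i)) b M => //.
  by move=> i; rewrite -lecR; apply: le_trans (fb i); exact: normc_ge_Im.
exists (x%:C + 'i * y%:C).
rewrite (_ : f = fun i => (complex.Re (f i))%:C + 'i * (complex.Im (f i))%:C).
  apply: has_sumD; last apply: has_sumZ; exact: has_sum_real_complex.
by apply/funext => i; rewrite -complex_i complex_etaE.
Qed.

End Complex.
End UnconditionalSums.

(** * The power series of the complex exponential *)

Section ExponentialSeries.
Context {R : realType}.
Local Open Scope classical_set_scope.
Local Notation C := R[i].
Local Notation Re := (@complex.Re R).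
Local Notation Im := (@complex.Im R).
Local Notation normc := (@Normc.normc R).
Implicit Types (z w : C) (x s : R) (n N : nat).

Lemma Re_le_normc z : `|Re z| <= normc z.
Proof. by rewrite -lecR; exact: (normc_ge_Re z). Qed.

Lemma Im_le_normc z : `|Im z| <= normc z.
Proof. by rewrite -lecR; exact: (normc_ge_Im z). Qed.

Lemma normcX z n : normc (z ^+ n) = normc z ^+ n.
Proof.
by apply: (@complexI R); rewrite rmorphXn; exact: (normrX n z).
Qed.

Lemma normc_real x : normc x%:C = `|x|.
Proof. by rewrite /= expr0n addr0 sqrtr_sqr. Qed.

Lemma normc_ge0 z : 0 <= normc z.
Proof. by case: z => x y; exact: sqrtr_ge0. Qed.

Lemma normc_cexp z : normc (cexp z) = expR (Re z).
Proof.
rewrite /cexp Normc.normcM normc_real ger0_norm ?expR_ge0 //=.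
by rewrite cos2Dsin2 sqrtr1 mulr1.
Qed.

Lemma mean_value_bound (f df : R -> R) M :
  (forall s, is_derive s 1 f (df s)) ->
  (forall s, 0 <= s <= 1 -> `|df s| <= M) -> `|f 1 - f 0| <= M.
Proof.
move=> fdf dfM; have [|s s01 ->] := @MVT R f df 0 1 ltr01 (fun s _ => fdf s).
  apply: continuous_subspaceT => s.
  by apply/differentiable_continuous/derivable1_diffP; case: (fdf s).
rewrite subr0 mulr1 dfM //; move: s01; rewrite in_itv /= => /andP[s0 s1].
by rewrite !ltW.
Qed.

Lemma cderiv_real (f : R -> R) s d :
  is_derive s 1 f d -> cderiv (fun u => (f u)%:C) s d%:C.
Proof. by split=> //=; exact: is_derive_cst. Qed.

(* Interpolates between the Taylor polynomial of degree [N] ([s = 0]) and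
   [cexp z] ([s = 1]); the derivative in [s] telescopes. *)
Let taylor z N s : C :=
  \sum_(n < N.+1) ((1 - s) ^+ n / n`!%:R)%:C * z ^+ n * cexp (s%:C * z).

Let cderiv_scaled_exp z s :
  cderiv (fun u => cexp (u%:C * z)) s (z * cexp (s%:C * z)).
Proof.
apply: cderiv_comp_cexp; have ds := cderiv_real (is_derive_id s (1 : R)).
by apply: cderiv_eq (cderivM ds (cderiv_cst z s)) _; rewrite mulr0 addr0 mul1r.
Qed.

Let is_derive_taylor_coef n s :
  is_derive s 1 (fun u => (1 - u) ^+ n.+1 / n.+1`!%:R)
    (- ((1 - s) ^+ n / n`!%:R)).
Proof.
have d1 : is_derive s 1 (fun u : R => 1 - u) (- 1).
  apply: is_derive_eq (is_deriveB (is_derive_cst (1 : R) s 1)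
    (is_derive_id s (1 : R))) _.
  by rewrite sub0r.
have := is_deriveZ (n.+1`!%:R^-1) (is_deriveX n.+1 d1).
rewrite (_ : _ \*: _ = (fun u : R => (1 - u) ^+ n.+1 / n.+1`!%:R)); last first.
  by apply/funext => u; rewrite !fctE [RHS]mulrC.
move=> d; apply: is_derive_eq d _.
rewrite /GRing.scale /= factS natrM.
by field; rewrite nat1r ?pnatr_eq0 -?lt0n ?fact_gt0.
Qed.

Let cderiv_taylor z N s : cderiv (taylor z N) s
  (((1 - s) ^+ N / N`!%:R)%:C * z ^+ N.+1 * cexp (s%:C * z)).
Proof.
elim: N => [|N IHN].
  rewrite (_ : taylor z 0 = fun u => cexp (u%:C * z)).
    apply: cderiv_eq (cderiv_scaled_exp z s) _.
    by rewrite expr0 fact0 divr1 rmorph1 mul1r expr1.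
  apply/funext => u; rewrite /taylor big_ord1.
  by rewrite expr0 fact0 divr1 rmorph1 mul1r expr0 mul1r.
rewrite (_ : taylor z N.+1 = fun u => taylor z N u +
    ((1 - u) ^+ N.+1 / N.+1`!%:R)%:C * (z ^+ N.+1 * cexp (u%:C * z))).
  have dc := cderiv_real (is_derive_taylor_coef N s).
  have de := cderivM (cderiv_cst (z ^+ N.+1) s) (cderiv_scaled_exp z s).
  apply: cderiv_eq (cderivD IHN (cderivM dc de)) _.
  move: ((1 - s) ^+ N / N`!%:R) ((1 - s) ^+ N.+1 / N.+1`!%:R) => a b.
  by rewrite rmorphN [z ^+ N.+2]exprS; ring.
by apply/funext => u; rewrite /taylor big_ord_recr /= mulrA.
Qed.

(** Equal to [|z|^(N+1) exp(|z|) / N!]; the form with [exp_coeff] gives its convergence to zero. *)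
Let taylor_bound z N := normc z * expR (normc z) * exp_coeff (normc z) N.

Let norm_taylor_derivative z N s : 0 <= s <= 1 ->
  normc (((1 - s) ^+ N / N`!%:R)%:C * z ^+ N.+1 * cexp (s%:C * z)) <=
  taylor_bound z N.
Proof.
move=> /andP[s0 s1].
rewrite Normc.normcM normc_cexp Normc.normcM normcX normc_real.
have r0 : 0 <= 1 - s by rewrite subr_ge0.
have nf0 : 0 < N`!%:R :> R by rewrite ltr0n fact_gt0.
rewrite ger0_norm ?divr_ge0 ?exprn_ge0 ?(ltW nf0) //.
rewrite /taylor_bound exp_coeffE.
rewrite [leRHS](_ : _ =
    N`!%:R^-1 * normc z ^+ N.+1 * expR (normc z)); last first.
  by rewrite exprS; ring.
apply: ler_pM; rewrite ?expR_ge0 ?mulr_ge0 ?invr_ge0 ?(ltW nf0) ?exprn_ge0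
  ?normc_ge0 //.
  rewrite ler_wpM2r ?exprn_ge0 ?normc_ge0 // ler_piMl ?invr_ge0 ?(ltW nf0) //.
  by rewrite exprn_ile1 // lerBlDr lerDl.
rewrite ler_expR Re_mulc /= mul0r subr0.
apply: le_trans (ler_norm _) _; rewrite normrM ger0_norm //.
apply: le_trans (Re_le_normc z).
by rewrite ler_piMl.
Qed.

Let taylor1 z N : taylor z N 1 = cexp z.
Proof.
rewrite /taylor big_ord_recl big1 => [|i _].
  by rewrite addr0 expr0 fact0 divr1 !rmorph1 !mul1r.
by rewrite subrr expr0n /= mul0r rmorph0 !mul0r.
Qed.

Let taylor0 z N : taylor z N 0 = \sum_(n < N.+1) z ^+ n / n`!%:R.
Proof.
apply: eq_bigr => n _; rewrite rmorph0 mul0r cexp0 mulr1 subr0 expr1n mul1r.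
by rewrite rmorphV ?unitfE ?pnatr_eq0 -?lt0n ?fact_gt0 // rmorph_nat mulrC.
Qed.

(** Real and imaginary parts are separate because the mean value theorem is for real-valued
    functions. *)
Lemma cexp_taylor z N :
  `|Re (cexp z) - Re (\sum_(n < N.+1) z ^+ n / n`!%:R)| <= taylor_bound z N /\
  `|Im (cexp z) - Im (\sum_(n < N.+1) z ^+ n / n`!%:R)| <= taylor_bound z N.
Proof.
rewrite -(taylor1 z N) -taylor0; split.
  apply: (mean_value_bound (f := fun s => Re (taylor z N s))).
    by move=> s; exact: (cderiv_taylor z N s).1.
  move=> s s01; apply: le_trans (norm_taylor_derivative z N s01).
  exact: Re_le_normc.
apply: (mean_value_bound (f := fun s => Im (taylor z N s))).
  by move=> s; exact: (cderiv_taylor z N s).2.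
move=> s s01; apply: le_trans (norm_taylor_derivative z N s01).
exact: Im_le_normc.
Qed.

Let taylor_bound_cvg z : taylor_bound z N @[N --> \oo] --> 0.
Proof.
rewrite -(mulr0 (normc z * expR (normc z))).
by apply: cvgM; [exact: cvg_cst|exact: cvg_exp_coeff].
Qed.

Lemma sum_exp_coeff_le x (A : {fset nat}) : 0 <= x ->
  \sum_(n <- A) exp_coeff x n <= expR x.
Proof.
move=> x0.
apply: sum_fset_le_nat => n; first exact: exp_coeff_ge0.
rewrite -(big_mkord xpredT) -[leLHS]/(series _ _).
apply: nondecreasing_cvgn_le; last exact: is_cvg_series_exp_coeff.
apply/nondecreasing_seqP => k.
by rewrite /series /= big_nat_recr //= lerDl exp_coeff_ge0.
Qed.

(** Domination by the real series gives some sum [s]; along initial segments the Taylor estimate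
    identifies [s] with [cexp z]. *)
Lemma has_sum_cexp z : has_sum (fun n => z ^+ n / n`!%:R) (cexp z).
Proof.
have [||s es] := @has_sum_dominatedC _ _ (fun n => z ^+ n / n`!%:R)
  (exp_coeff (normc z)) (expR (normc z)).
- move=> n; rewrite -[X in X <= _]/((normc _)%:C) lecR exp_coeffE.
  rewrite Normc.normcM normcX Normc.normcV -(rmorph_nat (real_complex R)).
  by rewrite normc_real ger0_norm // mulrC.
- by move=> A; apply: sum_exp_coeff_le; exact: normc_ge0.
(* [P] stands for the real or the imaginary part. *)
have lim0 (P : C -> R) : has_sum (fun n => P (z ^+ n / n`!%:R)) (P s) ->
    (forall N, \sum_(n < N.+1) P (z ^+ n / n`!%:R) =
      P (\sum_(n < N.+1) z ^+ n / n`!%:R)) ->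
    (forall N, `|P (cexp z) - P (\sum_(n < N.+1) z ^+ n / n`!%:R)| <=
      taylor_bound z N) -> P (cexp z) = P s.
  move=> /has_sum_cvgn Ps PE leP; rewrite -cvg_shiftS in Ps.
  suff lim : (\sum_(n < N.+1) P (z ^+ n / n`!%:R)) @[N --> \oo] -->
      (P (cexp z) : R^o) by exact: (cvg_unique (@norm_hausdorff _ R^o) lim Ps).
  apply/cvgrPdist_le => e e0.
  have /cvgrPdist_le/(_ e e0) := taylor_bound_cvg z.
  apply: filterS => N; rewrite sub0r normrN PE; apply: le_trans.
  by apply: le_trans (leP N) _; exact: ler_norm.
suff -> : cexp z = s by [].
apply: complex_eq.
  apply: lim0; first exact: has_sum_Re.
    by move=> N; rewrite (big_morph Re Re_addc (erefl _)).
  by move=> N; case: (cexp_taylor z N).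
apply: lim0; first exact: has_sum_Im.
  by move=> N; rewrite (big_morph Im Im_addc (erefl _)).
by move=> N; case: (cexp_taylor z N).
Qed.

Lemma has_sum_expR x : has_sum (fun n => x ^+ n / n`!%:R) (expR x).
Proof.
have := has_sum_Re (has_sum_cexp (z := x%:C)); rewrite cexp_real /=.
rewrite (_ : (fun n => complex.Re _) = fun n => x ^+ n / n`!%:R) //.
apply/funext => n; rewrite -(rmorph_nat (real_complex R)) -rmorphXn.
by rewrite -fmorphV -rmorphM.
Qed.

End ExponentialSeries.

(** * Laguerre polynomials *)

Section Laguerre.
Context {R : realType}.
Variable q : R.
Hypotheses (q_ge0 : 0 <= q) (q_lt1 : q < 1).
Implicit Types (x : R) (m i n : nat).

Definition laguerre m x : R :=
  \sum_(i < m.+1) 'C(m, i)%:R * ((- x) ^+ i / i`!%:R).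

Let q1_gt0 : 0 < 1 - q.
Proof. by rewrite subr_gt0. Qed.

Let q1_neq0 : 1 - q != 0.
Proof. by rewrite gt_eqF. Qed.

(** The expected value of [sum_m C(m,i) q^m]; the two identities that follow express Pascal's rule
    for it. *)
Let binomial_sum i : R := q ^+ i / (1 - q) ^+ i.+1.

Let binomial_sum0 : 1 + q * binomial_sum 0 = binomial_sum 0.
Proof. by rewrite /binomial_sum expr0 expr1; field. Qed.

Let binomial_sumS i :
  q * (binomial_sum i.+1 + binomial_sum i) = binomial_sum i.+1.
Proof. by rewrite /binomial_sum !exprS; field; rewrite q1_neq0 expf_neq0. Qed.

Let binomial_sum_ge0 i : 0 <= binomial_sum i.
Proof. by rewrite /binomial_sum divr_ge0 ?exprn_ge0 // ltW. Qed.

(** Pascal's rule expresses the partial sums to [N + 1] by [q] times those to [N], and the closed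
    form is a fixed point of this step. *)
Let binomial_partial_sum i N :
  \sum_(m < N) 'C(m, i)%:R * q ^+ m <= binomial_sum i.
Proof.
elim: N i => [|N IHN] [|i]; rewrite ?big_ord0 //.
  rewrite big_ord_recl bin0 expr0 mulr1 -binomial_sum0 lerD2l.
  apply: le_trans (ler_wpM2l q_ge0 (IHN 0%N)).
  rewrite mulr_sumr ler_sum // => m _.
  by rewrite !bin0 !mul1r -exprS.
rewrite big_ord_recl bin0n mul0r add0r -binomial_sumS.
apply: le_trans (ler_wpM2l q_ge0 (lerD (IHN i.+1) (IHN i))).
rewrite -big_split mulr_sumr ler_sum // => m _ /=.
by rewrite /bump /= add1n binS natrD exprS; rewrite le_eqVlt; apply/orP; left;
  apply/eqP; ring.
Qed.

(** Once the sum [s] exists, splitting off [m = 0] and Pascal's rule give a linear equation for [s],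
    solvable because [1 - q] is nonzero. *)
Lemma has_sum_binomial i :
  has_sum (fun m => 'C(m, i)%:R * q ^+ m) (binomial_sum i).
Proof.
have ex j : exists s, has_sum (fun m => 'C(m, j)%:R * q ^+ m) s.
  apply: (@has_sum_ge0_bounded _ _ _ (binomial_sum j)) => [m|].
    by rewrite mulr_ge0 // exprn_ge0.
  apply: sum_fset_le_nat => [m|N]; last exact: binomial_partial_sum.
  by rewrite mulr_ge0 // exprn_ge0.
elim: i => [|i IHi].
  have [s fs] := ex 0%N.
  have : has_sum (fun m => 'C(m, 0)%:R * q ^+ m) ('C(0, 0)%:R * q ^+ 0 + q * s).
    apply: (has_sum_nat_recl (f := fun m => 'C(m, 0)%:R * q ^+ m)).
    rewrite (_ : (fun n => _) = fun n => q * ('C(n, 0)%:R * q ^+ n)).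
      exact: has_sumZ.
    by apply/funext => n; rewrite !bin0 !mul1r exprS.
  move=> /(has_sum_unique fs); rewrite bin0 expr0 mulr1 => es.
  suff <- : s = binomial_sum 0 by [].
  apply: (mulfI q1_neq0); rewrite mulrBl mul1r {1}es addrK.
  by rewrite /binomial_sum; field.
have [s fs] := ex i.+1.
have : has_sum (fun m => 'C(m, i.+1)%:R * q ^+ m)
    ('C(0, i.+1)%:R * q ^+ 0 + q * (s + binomial_sum i)).
  apply: (has_sum_nat_recl (f := fun m => 'C(m, i.+1)%:R * q ^+ m)).
  rewrite (_ : (fun n => _) =
      fun n => q * ('C(n, i.+1)%:R * q ^+ n + 'C(n, i)%:R * q ^+ n)).
    exact/has_sumZ/has_sumD.
  by apply/funext => n; rewrite binS natrD exprS; ring.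
move=> /(has_sum_unique fs); rewrite bin0n mul0r add0r => es.
suff <- : s = binomial_sum i.+1 by [].
apply: (mulfI q1_neq0); rewrite mulrBl mul1r {1}es.
rewrite /binomial_sum [q ^+ i.+1]exprS [_ ^+ i.+2]exprS.
by field; rewrite q1_neq0 expf_neq0.
Qed.

(** The Laguerre polynomials are expanded and the order of summation exchanged: summing over [m]
    first gives [binomial_sum], and an exponential series in [- x q / (1 - q)] remains. The same
    computation with [|x|] supplies the bound. *)
Lemma has_sum_laguerre x : has_sum (fun m => q ^+ m * laguerre m x)
  (expR (- x * q / (1 - q)) / (1 - q)).
Proof.
pose f (p : nat * nat) :=
  (- x) ^+ p.1 / p.1`!%:R * ('C(p.2, p.1)%:R * q ^+ p.2).
pose b (p : nat * nat) :=
  `|x| ^+ p.1 / p.1`!%:R * ('C(p.2, p.1)%:R * q ^+ p.2).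
have xi0 i : 0 <= `|x| ^+ i / i`!%:R by rewrite divr_ge0 // exprn_ge0.
have [s fs] : exists s, has_sum f s.
  apply: (@has_sum_dominated _ _ f b ((1 - q)^-1 * expR (`|x| * q / (1 - q)))).
    move=> p; rewrite /f /b normrM normrM normrM normfV !normrX normrN.
    by rewrite !normr_nat (ger0_norm q_ge0).
  apply: (@sum_fset_le_rows _ _ _ b
      (fun i => (1 - q)^-1 * exp_coeff (`|x| * q / (1 - q)) i)).
  - by move=> p; rewrite !mulr_ge0 // exprn_ge0.
  - move=> i B; rewrite /b /= -mulr_sumr.
    rewrite [leRHS](_ : _ = `|x| ^+ i / i`!%:R * binomial_sum i).
      apply: ler_wpM2l => //; apply: has_sum_ge0_le => [m|].
        by rewrite mulr_ge0 // exprn_ge0.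
      exact: has_sum_binomial.
    rewrite exp_coeffE !exprMn exprVn /binomial_sum exprS.
    by field; rewrite q1_neq0 expf_neq0 // pnatr_eq0 -lt0n fact_gt0.
  - move=> A; rewrite -mulr_sumr ler_wpM2l ?invr_ge0 ?(ltW q1_gt0) //.
    by apply: sum_exp_coeff_le; rewrite divr_ge0 ?mulr_ge0 // ltW.
have -> : expR (- x * q / (1 - q)) / (1 - q) = s.
  have := has_sum_rows fs (fun i =>
    has_sumZ ((- x) ^+ i / i`!%:R) (@has_sum_binomial i)).
  apply: has_sum_unique; rewrite mulrC.
  rewrite (_ : (fun i => _) =
      fun i => (1 - q)^-1 * ((- x * q / (1 - q)) ^+ i / i`!%:R)).
    exact/has_sumZ/has_sum_expR.
  apply/funext => i; rewrite !exprMn exprVn /binomial_sum exprS.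
  by field; rewrite q1_neq0 expf_neq0 // pnatr_eq0 -lt0n fact_gt0.
(* For fixed [m] the sum over [i] is finite, since ['C(m, i)] vanishes for [i > m]. *)
apply: (has_sum_cols fs) => m.
rewrite (_ : q ^+ m * laguerre m x = \sum_(i < m.+1) f (nat_of_ord i, m)).
  apply: has_sum_finite => i ltmi.
  by rewrite /f /= bin_small // mul0r mulr0.
by rewrite /laguerre mulr_sumr; apply: eq_bigr => i _; rewrite /f /=; ring.
Qed.

End Laguerre.

(** * The bilinear sums of Hermite polynomials *)

Section HermiteSums.
Context {R : realType}.
Local Notation C := R[i].
Variable nu : R.
Hypothesis nu_gt0 : 0 < nu.
Implicit Types (z w : C) (m n k : nat).
Local Notation h := (hermite_poly nu).

Let nuC_neq0 : nu%:C != 0 :> C.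
Proof. by rewrite fmorph_eq0 gt_eqF. Qed.

Lemma natrC_fact_neq0 n : n`!%:R != 0 :> C.
Proof. by rewrite pnatr_eq0 -lt0n fact_gt0. Qed.

(** The product of the weights of [m] and [n] is [pi / nu] times the inverse squared norm of
    [H_{m,n}]. *)
Definition hermite_weight n : C := (nu%:C ^+ n * n`!%:R)^-1.

Let hermite_weightS n :
  hermite_weight n.+1 * (nu%:C * n.+1%:R) = hermite_weight n.
Proof.
rewrite /hermite_weight exprS factS natrM; field.
by rewrite natrC_fact_neq0 nat1r pnatr_eq0 expf_neq0.
Qed.

(** The term at [n = 0] vanishes, and at [n + 1] the factor [nu (n + 1)] turns one weight into the
    previous one. *)
Let has_sum_shift m k z w s :
  has_sum (fun n => hermite_weight n * (h m n z * h n.+1 k w)) s ->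
  has_sum (fun n => hermite_weight n * (nu%:C * n%:R * h m n.-1 z * h n k w)) s.
Proof.
move=> fs; rewrite -[s]add0r.
have <- : hermite_weight 0 * (nu%:C * 0%:R * h m 0.-1 z * h 0 k w) = 0.
  by rewrite mulr0n; ring.
apply: (has_sum_nat_recl (f := fun n => hermite_weight n *
  (nu%:C * n%:R * h m n.-1 z * h n k w))) => /=.
rewrite (_ : (fun n => _) =
  fun n => hermite_weight n * (h m n z * h n.+1 k w)) //.
by apply/funext => n; rewrite -(hermite_weightS n); ring.
Qed.

Let has_sum_shift' m k z w s :
  has_sum (fun n => hermite_weight n * (h m n.+1 z * h n k w)) s ->
  has_sum (fun n => hermite_weight n * (nu%:C * n%:R * h m n z * h n.-1 k w)) s.
Proof.
move=> fs; rewrite -[s]add0r.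
have <- : hermite_weight 0 * (nu%:C * 0%:R * h m 0 z * h 0.-1 k w) = 0.
  by rewrite mulr0n; ring.
apply: (has_sum_nat_recl (f := fun n => hermite_weight n *
  (nu%:C * n%:R * h m n z * h n.-1 k w))) => /=.
rewrite (_ : (fun n => _) =
  fun n => hermite_weight n * (h m n.+1 z * h n k w)) //.
by apply/funext => n; rewrite -(hermite_weightS n); ring.
Qed.

(* [h n k w] is the conjugate of [h k n w], so for [k = m] this is, up to a
   factor, the reproducing kernel of the [m]-th Landau level. *)
Lemma has_sum_landau_level m k z w :
  has_sum (fun n => hermite_weight n * (h m n z * h n k w))
    (cexp (nu%:C * (z^* * w)) * ((-1) ^+ k * h m k (z - w))).
Proof.
elim: m k => [|m IHm] k.
  elim: k => [|k IHk].
    rewrite hermite_poly0 !expr0 !mulr1.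
    rewrite (_ : (fun n => _) = fun n => (nu%:C * (z^* * w)) ^+ n / n`!%:R).
      exact: has_sum_cexp.
    apply/funext => n; rewrite hermite_poly0 -(conj_hermite_poly nu 0 n).
    rewrite hermite_poly0 rmorphXn rmorphM /= conjCK.
    rewrite [(nu%:C)^*]conjc_real /hermite_weight !exprMn.
    by field; rewrite natrC_fact_neq0 expf_neq0.
  have sh := has_sumZ (nu%:C * z^*) IHk.
  (* For [m = 0], multiplying by [nu] and the conjugate of [z] raises [n]; the shift converts this
     into the lower term of the recursion for [h n k.+1 w]. *)
  have : has_sum
      (fun n => hermite_weight n * (nu%:C * n%:R * h 0 n z * h n.-1 k w))
      (nu%:C * z^* * (cexp (nu%:C * (z^* * w)) * ((-1) ^+ k * h 0 k (z - w)))).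
    apply: has_sum_shift'; congr (has_sum _ _) : sh.
    by apply/funext => n; rewrite !hermite_poly0 exprS; ring.
  move=> /(has_sumB (has_sumZ (nu%:C * w^*) IHk)).
  rewrite (_ : _ - _ = cexp (nu%:C * (z^* * w)) *
      ((-1) ^+ k.+1 * h 0 k.+1 (z - w))); last first.
    by rewrite !hermite_poly0 !exprS rmorphB /=; ring.
  congr (has_sum _ _); apply/funext => n.
  by rewrite [h n k.+1 w]hermite_polySr; ring.
(* The lower term of [h m.+1 n z] shifts [n]; by [has_sum_shift] its sum equals one with
   [h n.+1 k w], which the recursion reduces to [k] and [k.-1]. *)
have IHw : has_sum (fun n => hermite_weight n * (h m n z * h n.+1 k w))
    (cexp (nu%:C * (z^* * w)) * ((-1) ^+ k *
      (nu%:C * w * h m k (z - w) + nu%:C * k%:R * h m k.-1 (z - w)))).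
  have := has_sumB (has_sumZ (nu%:C * w) (IHm k))
    (has_sumZ (nu%:C * k%:R) (IHm k.-1)).
  rewrite (_ : _ - _ = cexp (nu%:C * (z^* * w)) * ((-1) ^+ k *
      (nu%:C * w * h m k (z - w) + nu%:C * k%:R * h m k.-1 (z - w)))).
    congr (has_sum _ _); apply/funext => n.
    by rewrite [h n.+1 k w]hermite_polySl; ring.
  by case: k {IHm} => [|k]; rewrite ?mulr0n /= ?exprS; ring.
have := has_sumB (has_sumZ (nu%:C * z) (IHm k)) (has_sum_shift IHw).
rewrite (_ : _ - _ = cexp (nu%:C * (z^* * w)) *
    ((-1) ^+ k * h m.+1 k (z - w))).
  congr (has_sum _ _); apply/funext => n.
  by rewrite [h m.+1 n z]hermite_polySl; ring.
by rewrite hermite_polySl; ring.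
Qed.

(* [X m j = h m (n - j) (- nu)^j n (n - 1) ... (n - j + 1)] satisfies the
   Pascal-type recursion [X (m + 1) j = nu z X m j + X m (j + 1)]. *)
Lemma hermite_poly_binomial m n z : h m n z =
  \sum_(i < m.+1) 'C(m, i)%:R * (nu%:C * z) ^+ i *
    ((- nu%:C) ^+ (m - i) * (n ^_ (m - i))%:R * (nu%:C * z^*) ^+ (n - (m - i))).
Proof.
pose X m j := h m (n - j) z * ((- nu%:C) ^+ j * (n ^_ j)%:R).
have XS k j : X k.+1 j = nu%:C * z * X k j + X k j.+1.
  rewrite /X hermite_polySl ffactnSr natrM exprS subnS.
  by ring.
have XE k j : X k j =
    \sum_(i < k.+1) 'C(k, i)%:R * (nu%:C * z) ^+ i * X 0 (k - i + j)%N.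
  elim: k j => [|k IHk] j; first by rewrite big_ord1 bin0 expr0 !mul1r.
  rewrite XS !IHk [RHS]big_ord_recl bin0 expr0 !mul1r subn0.
  under [X in _ = _ + X]eq_bigr => i _.
    rewrite lift0 binS natrD exprS subSS 2!mulrDl.
    over.
  rewrite big_split [RHS]addrA mulr_sumr [LHS]addrC; congr (_ + _); last first.
    by apply: eq_bigr => i _; ring.
  transitivity (\sum_(i < k.+2) 'C(k, i)%:R * (nu%:C * z) ^+ i *
      X 0 (k.+1 - i + j)%N).
    rewrite [RHS]big_ord_recr /= bin_small // !mul0r addr0.
    apply: eq_bigr => i _; congr (_ * X _ _).
    by rewrite subSn ?addSnnS // -ltnS.
  rewrite big_ord_recl bin0 expr0 !mul1r subn0; congr (_ + _).
  by apply: eq_bigr => i _; rewrite lift0 subSS exprS.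
have := XE m 0%N; rewrite {1}/X subn0 expr0 ffactn0 !mulr1 => ->.
apply: eq_bigr => i _; rewrite addn0 /X hermite_poly0.
by congr (_ * _); rewrite mulrC.
Qed.

(** For [n = m] the exponent [n - (m - i)] is [i], so [z] and its conjugate pair up to powers of
    [|z|^2]; the falling factorial times [i!] is [m!]. *)
Lemma hermite_poly_diag m z : h m m z =
  ((-1) ^+ m * nu ^+ m * m`!%:R * laguerre m (nu * Normc.normc z ^+ 2))%:C.
Proof.
rewrite hermite_poly_binomial /laguerre mulr_sumr rmorph_sum.
apply: eq_bigr => i _; have lim : (i <= m)%N by rewrite -ltnS.
move: (nat_of_ord i) lim => k lim.
rewrite subKn // -(ffact_fact (leq_subr k m)) subKn //.
rewrite -[in (-1) ^+ m](subnK lim) -[in nu ^+ m](subnK lim) !exprD.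
move: (m - k)%N => d.
have fk : k`!%:R != 0 :> R by rewrite pnatr_eq0 -lt0n fact_gt0.
transitivity ('C(m, k)%:R * nu ^+ k * nu ^+ k * (Normc.normc z ^+ 2) ^+ k *
    ((-1) ^+ d * nu ^+ d * (m ^_ d)%:R))%:C.
  rewrite !rmorphM !rmorphXn !rmorph_nat /= rmorphN1.
  have -> : (Normc.normc z)%:C ^+ 2 = z * z^*.
    by rewrite -sqr_normc_complex rmorphXn.
  by rewrite -[- nu%:C]mulN1r !exprMn; ring.
congr (_%:C); rewrite natrM -[- (nu * _)]mulN1r !exprMn.
have s2 : (-1) ^+ k * (-1) ^+ k = 1 :> R by rewrite -exprMn mulrNN mulr1 expr1n.
move: ((-1) ^+ k) ((-1) ^+ d) s2 => s t s2.
by rewrite -[LHS]mul1r -{1}s2; field.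
Qed.

Lemma laguerre_at0 m : laguerre m 0 = 1 :> R.
Proof.
rewrite /laguerre big_ord_recl bin0 expr0 divr1 mulr1 big1 ?addr0 // => i _.
by rewrite oppr0 expr0n /= mul0r mulr0.
Qed.

Let weight n : R := (nu ^+ n * n`!%:R)^-1.

Let weight_ge0 n : 0 <= weight n.
Proof. by rewrite invr_ge0 mulr_ge0 // exprn_ge0 // ltW. Qed.

Let hermite_weightE n : hermite_weight n = (weight n)%:C.
Proof. by rewrite fmorphV rmorphM rmorphXn rmorph_nat. Qed.

Let weightK m : weight m * (nu ^+ m * m`!%:R) = 1.
Proof.
by rewrite mulVf // mulf_neq0 ?expf_neq0 ?gt_eqF // ltr0n fact_gt0.
Qed.

(** The level sum at [w = z], where the Laguerre factor is 1. Its factor [nu^m m!] cancels against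
    [weight m], which leaves a geometric series in [q] as the bound for the double sum. *)
Let landau_level_sqnorm m z :
  has_sum (fun n => weight n * Normc.normc (h m n z) ^+ 2)
    (expR (nu * Normc.normc z ^+ 2) * (nu ^+ m * m`!%:R)).
Proof.
have := has_sum_Re (has_sum_landau_level (m := m) (k := m) (z := z) (w := z)).
rewrite subrr hermite_poly_diag Normc.normc0 expr0n mulr0 laguerre_at0 mulr1.
rewrite [z^* * z]mulrC -sqr_normc_complex -rmorphM cexp_real.
rewrite [X in complex.Re X](_ : _ =
    (expR (nu * Normc.normc z ^+ 2) * (nu ^+ m * m`!%:R))%:C); last first.
  have -> : (-1) ^+ m = ((-1) ^+ m)%:C :> C by rewrite rmorphXn rmorphN1.
  rewrite -!rmorphM; congr (_%:C); rewrite !mulrA; congr (_ * _ * _).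
  by rewrite -[_ * (-1) ^+ m * _]mulrA -exprMn mulrNN mulr1 expr1n mulr1.
congr (has_sum _ _); apply/funext => n.
rewrite -(conj_hermite_poly nu m n) -sqr_normc_complex hermite_weightE.
by rewrite -rmorphM.
Qed.

Variable q : R.
Hypotheses (q_ge0 : 0 <= q) (q_lt1 : q < 1).

(** The summand of the heat kernel up to the factor [nu / pi], with [exp(- nu t)] for [q]. *)
Definition kernel_term z w (p : nat * nat) : C := (q ^+ p.1)%:C *
  hermite_weight p.1 * (hermite_weight p.2 * (h p.1 p.2 z * h p.2 p.1 w)).

Let summable_kernel_term z w : exists s, has_sum (kernel_term z w) s.
Proof.
pose N z (p : nat * nat) := Normc.normc (h p.1 p.2 z).
pose E z := expR (nu * Normc.normc z ^+ 2).
pose b p := q ^+ p.1 * weight p.1 / 2 *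
  (weight p.2 * N z p ^+ 2 + weight p.2 * N w p ^+ 2).
have c0 m : 0 <= q ^+ m * weight m / 2.
  by rewrite mulr_ge0 ?invr_ge0 // mulr_ge0 ?weight_ge0 // exprn_ge0.
apply: (@has_sum_dominatedC _ _ _ b ((E z + E w) / 2 * (1 - q)^-1)).
  move=> p; rewrite -[X in X <= _]/((Normc.normc _)%:C) lecR /kernel_term.
  rewrite !hermite_weightE -rmorphM !Normc.normcM !normc_real.
  rewrite -(conj_hermite_poly nu p.1 p.2 w).
  have -> : Normc.normc ((h p.1 p.2 w)^*) = N w p.
    by apply: (@complexI R); exact: normcJ.
  rewrite !ger0_norm ?weight_ge0 ?mulr_ge0 ?weight_ge0 ?exprn_ge0 //.
  rewrite -/(N z p) /b; set a := N z p; set a' := N w p.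
  set c := q ^+ p.1 * weight p.1 * weight p.2.
  have c_ge0 : 0 <= c by rewrite !mulr_ge0 ?weight_ge0 // exprn_ge0.
  rewrite [leLHS](_ : _ = c * (a * a')); last by rewrite /c; ring.
  rewrite [leRHS](_ : _ = c * ((a ^+ 2 + a' ^+ 2) / 2)); last first.
    by rewrite /c; ring.
  rewrite ler_wpM2l // ler_pdivlMr // -subr_ge0.
  by rewrite (_ : _ - _ = (a - a') ^+ 2) ?sqr_ge0 //; ring.
apply: (@sum_fset_le_rows _ _ _ b (fun m => (E z + E w) / 2 * q ^+ m)).
- move=> p; rewrite mulr_ge0 // addr_ge0 // mulr_ge0 ?weight_ge0 //;
    exact: sqr_ge0.
- move=> m B; rewrite /b /= -mulr_sumr big_split /=.
  have lz u : \sum_(n <- B) weight n * N u (m, n) ^+ 2 <=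
      E u * (nu ^+ m * m`!%:R).
    apply: has_sum_ge0_le => [n|]; last exact: landau_level_sqnorm.
    by rewrite mulr_ge0 ?weight_ge0 // sqr_ge0.
  apply: le_trans (ler_wpM2l (c0 m) (lerD (lz z) (lz w))) _.
  rewrite [leLHS](_ : _ = (E z + E w) / 2 * q ^+ m *
    (weight m * (nu ^+ m * m`!%:R))); last by ring.
  by rewrite weightK mulr1.
- move=> A; rewrite -mulr_sumr ler_wpM2l //.
    by rewrite divr_ge0 ?addr_ge0 // expR_ge0.
  have -> : (1 - q)^-1 = q ^+ 0 / (1 - q) ^+ 1 by rewrite expr0 mul1r expr1.
  rewrite (eq_bigr (fun m => 'C(m, 0)%:R * q ^+ m)); last first.
    by move=> m _; rewrite bin0 mul1r.
  apply: has_sum_ge0_le => [m|]; last exact: has_sum_binomial.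
  by rewrite mulr_ge0 // exprn_ge0.
Qed.

Lemma has_sum_hermite_kernel z w : has_sum (kernel_term z w)
  (cexp (nu%:C * (z^* * w)) *
   (expR (- (nu * Normc.normc (z - w) ^+ 2) * q / (1 - q)) / (1 - q))%:C).
Proof.
have [s fs] := summable_kernel_term z w.
rewrite (_ : _ * _ = s) //.
have := has_sum_rows fs (fun m => has_sumZ ((q ^+ m)%:C * hermite_weight m)
  (has_sum_landau_level (m := m) (k := m) (z := z) (w := w))).
apply: has_sum_unique.
have := has_sumZ (cexp (nu%:C * (z^* * w))) (has_sum_real_complex
  (has_sum_laguerre q_ge0 q_lt1 (x := nu * Normc.normc (z - w) ^+ 2))).
congr (has_sum _ _); apply/funext => m.
rewrite hermite_poly_diag hermite_weightE.
have -> : (-1) ^+ m = ((-1) ^+ m)%:C :> C by rewrite rmorphXn rmorphN1.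
rewrite [RHS]mulrCA -!rmorphM; congr (_ * _%:C).
have s2 : (-1) ^+ m * (-1) ^+ m = 1 :> R.
  by rewrite -exprMn mulrNN mulr1 expr1n.
(* The sign of the level sum cancels that of the diagonal value, and the weight cancels
   [nu^m m!]. *)
transitivity (((-1) ^+ m * (-1) ^+ m) * (weight m * (nu ^+ m * m`!%:R)) *
  (q ^+ m * laguerre m (nu * Normc.normc (z - w) ^+ 2))).
  by rewrite s2 weightK !mul1r.
by ring.
Qed.

End HermiteSums.

(** * Assembling the heat kernel *)

Section HeatKernel.
Context {R : realType}.
Local Notation C := R[i].
Variable nu : R.
Hypothesis nu_gt0 : 0 < nu.
Implicit Types (t : R) (z w : C) (j : nat * nat).

Lemma eigenfunction_hermite_onb j :
  eigenfunction (magnetic_laplacian nu) (nu * j.1%:R) (hermite_onb nu j).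
Proof.
have L_gt0 := L2norm_hermite_gt0 nu_gt0 j.1 j.2.
split.
  have [z hz] := hermite_neq0 nu_gt0 j.1 j.2; exists z.
  by rewrite /hermite_onb mulf_neq0 // invr_eq0 fmorph_eq0 gt_eqF.
have -> : hermite_onb nu j =
    fun w => (L2norm nu (hermite nu j.1 j.2))%:C^-1 * hermite_poly nu j.1 j.2 w.
  by apply/funext => w; rewrite /hermite_onb hermiteE mulrC.
by move=> z; exact: eigen_hermite_poly.
Qed.

Lemma eigenfunction_unique (L : (C -> C) -> C -> C) (a b : R) f :
  eigenfunction L a f -> eigenfunction L b f -> a = b.
Proof.
move=> [[z fz] La] [_ Lb]; apply: (@complexI R); apply: (mulIf fz).
by rewrite -La -Lb.
Qed.

Lemma has_sum_heat_kernel t z w : 0 < t ->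
  has_sum (fun j => (expR (- (nu * j.1%:R) * t))%:C *
      hermite_onb nu j z * (hermite_onb nu j w)^*)
    ((nu / pi)%:C
      * (cexp (nu%:C * (t%:C + w * z^*)) / ((expR (nu * t))%:C - 1))
      * cexp (- nu%:C * `|z - w| ^+ 2 / ((expR (nu * t))%:C - 1))).
Proof.
move=> t_gt0; pose E := expR (nu * t).
have E_gt0 : 0 < E by exact: expR_gt0.
have E_gt1 : 1 < E by rewrite expR_gt1 mulr_gt0.
have E1_neq0 : E - 1 != 0 by rewrite subr_eq0 gt_eqF.
have q_ge0 : 0 <= E^-1 by rewrite invr_ge0 ltW.
have q_lt1 : E^-1 < 1 by rewrite invf_lt1.
pose N2 := Normc.normc (z - w) ^+ 2.
(* With [q = 1 / E] one has [1 / (1 - q) = E / (E - 1)], the source of [exp(nu t)] in the numerator,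
   and [q / (1 - q) = 1 / (E - 1)] in the exponent. *)
have closed_form : cexp (nu%:C * (z^* * w)) *
      (expR (- (nu * N2) * E^-1 / (1 - E^-1)) / (1 - E^-1))%:C =
    cexp (nu%:C * (t%:C + w * z^*)) / (E%:C - 1) *
    cexp (- nu%:C * `|z - w| ^+ 2 / (E%:C - 1)).
  have -> : E%:C - 1 = (E - 1)%:C by rewrite rmorphB rmorph1.
  have -> : `|z - w| ^+ 2 = N2%:C by rewrite rmorphXn.
  have -> : - nu%:C * N2%:C / (E - 1)%:C = (- nu * N2 / (E - 1))%:C.
    by rewrite !rmorphM rmorphN fmorphV.
  rewrite cexp_real mulrDr cexpD -rmorphM cexp_real -/E [w * z^*]mulrC.
  have -> : - nu * N2 / (E - 1) = - (nu * N2) * E^-1 / (1 - E^-1).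
    by field; rewrite E1_neq0 gt_eqF.
  move: (cexp _) (expR _) => e x; transitivity (e * (E / (E - 1) * x)%:C).
    by congr (_ * _%:C); field; rewrite E1_neq0 gt_eqF.
  by rewrite !rmorphM fmorphV; ring.
have := has_sumZ (nu / pi)%:C
  (has_sum_hermite_kernel nu_gt0 q_ge0 q_lt1 (z := z) (w := w)).
rewrite closed_form [X in has_sum _ X -> _]mulrA.
congr (has_sum _ _); apply/funext => -[m n] /=.
rewrite /kernel_term /hermite_onb /= !hermiteE.
have -> : - (nu * m%:R) * t = m%:R * - (nu * t) by ring.
rewrite expRM_natl expRN -/E.
rewrite [(_ / _)^*]rmorphM /= conj_hermite_poly [(_^-1)^*]fmorphV /=.
rewrite [(_%:C)^*]conjc_real.
have L2 := L2norm_hermite nu_gt0 m n; rewrite hermiteE in L2.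
set L := L2norm _ _ in L2 *.
(* The normalisation of the two basis functions yields both weights and the prefactor [nu / pi]. *)
have Lweight : L%:C^-1 * L%:C^-1 =
    (nu / pi)%:C * hermite_weight nu m * hermite_weight nu n.
  rewrite -invfM -expr2 -rmorphXn [L ^+ 2]L2 /hermite_weight.
  rewrite -!rmorphXn -!(rmorph_nat (real_complex R)) -!rmorphM -!fmorphV.
  rewrite -!rmorphM; congr (_%:C); rewrite exprD.
  move: (@pi R) (pi_gt0 R) => c c_gt0; field.
  by rewrite !expf_neq0 ?gt_eqF // ltr0n fact_gt0.
transitivity ((E^-1 ^+ m)%:C * (hermite_poly nu m n z * hermite_poly nu n m w) *
  (L%:C^-1 * L%:C^-1)); first by rewrite Lweight; ring.
by ring.
Qed.

End HeatKernel.

Theorem theorem3p3 (R : realType) (nu : R) (K : R -> R[i] -> R[i] -> R[i]) :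
  0 < nu ->
  is_heat_kernel (magnetic_laplacian nu) (hermite_onb nu) K <->
  (forall (t : R) (z z0 : R[i]), 0 < t ->
    K t z z0 =
      (nu / pi)%:C
      * (cexp (nu%:C * (t%:C + z0 * z^*)) / ((expR (nu * t))%:C - 1))
      * cexp (- nu%:C * `|z - z0| ^+ 2 / ((expR (nu * t))%:C - 1))).
Proof.
move=> nu_gt0; split=> [[lam [lamP lamK]] t z z0 t_gt0|KE].
  have lamE : lam = fun j => nu * j.1%:R.
    apply/funext => j.
    exact: eigenfunction_unique (lamP j) (eigenfunction_hermite_onb nu_gt0 j).
  have := lamK t z z0 t_gt0; rewrite lamE => Kt.
  exact: has_sum_unique Kt (has_sum_heat_kernel nu_gt0 t_gt0).
exists (fun j => nu * j.1%:R); split.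
  by move=> j; exact: eigenfunction_hermite_onb.
move=> t z z0 t_gt0; rewrite KE //.
exact: has_sum_heat_kernel.
Qed.
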